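(* Let $U\subset P(m)$ be a shifted order ideal. If $t\ge 0$ is any integer, then the generic initial ideal of the Stanley-Reisner ideal of the squeezed complex $\Delta_t(U)$ is $$\operatorname{gin}(I_{\Delta_t(U)})=I(U)\cdot P(m+t+d_{\max}(U)).$$
   Context: Notation. $\mathbb{K}$ is a field, $m\ge 1$, $P(n)=\mathbb{K}[x_1,\ldots,x_n]$; $[n]=\{1,\ldots,n\}$ and $[a,b]=\{c\in\mathbb{N} : a\le c\le b\}$ (empty if $a>b$). For a homogeneous ideal $I\subset P(n)$, $\operatorname{gin}(I)$ denotes its generic initial ideal with respect to the degree reverse lexicographic order with $x_1>x_2>\cdots>x_n$ (if $\mathbb{K}$ is finite, it is understood after passing to an infinite extension field). Order ideals. A monomial order ideal of $P(m)$ is a finite set $U$ of monomials of $P(m)$ closed under taking divisors; it is always assumed that $1,x_1,\ldots,x_m\in U$. $U$ is shifted if $x_iu\in U$ ($u$ a monomial) and $i<j\le m$ imply $x_ju\in U$. $d_{\max}(U)$ is the maximal degree of a monomial in $U$. $I(U)$ is the monomial ideal of $P(m)$ generated by all monomials of $P(m)$ not in $U$. Squeezed complexes. Put $d=d_{\max}(U)$ and let $t\ge 0$ be an integer. For $u=x_{i_1}\cdots x_{i_s}\in U$ with $i_1\le\cdots\le i_s$ set $$F_t(u)=\bigcup_{\ell=1}^s\{i_\ell+2(\ell-1),\,i_\ell+2\ell-1\}\cup[m+2s+1,\,m+t+d]\quad\text{if } s\le t,$$ $$F_t(u)=\bigcup_{\ell=1}^t\{i_\ell+2(\ell-1),\,i_\ell+2\ell-1\}\cup\bigcup_{\ell=t+1}^s\{i_\ell+\ell+t-1\}\cup[m+t+s+1,\,m+t+d]\quad\text{if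 } s\ge t.$$ Each $F_t(u)$ is a $(d+t)$-subset of $[m+t+d]$. $\Delta_t(U)$ is the pure $(d+t-1)$-dimensional simplicial complex on vertex set $[m+t+d]$ whose facets are the sets $F_t(u)$, $u\in U$. Its Stanley-Reisner ideal $I_{\Delta_t(U)}\subset P(m+t+d)$ is generated by the squarefree monomials $\prod_{i\in F}x_i$ with $F\subseteq[m+t+d]$, $F\notin\Delta_t(U)$. *)

(* Defs.v *)
From HB Require Import structures.
From mathcomp Require Import all_boot all_order all_algebra.
From mathcomp Require Import finmap.
From mathcomp Require Import freeg mpoly.

Set Implicit Arguments.
Unset Strict Implicit.
Unset Printing Implicit Defensive.

Import GRing.Theory.
Local Open Scope ring_scope.

(* Indices are shifted by one: the variable x_(k+1) is 'X_k with k : 'I_n, and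
   the vertex k+1 of a complex on [n] is k : 'I_n. *)

Definition ideal_gen (R : comNzRingType) (G : R -> Prop) (p : R) : Prop :=
  exists s : seq (R * R),
    (forall cg, cg \in s -> G cg.2) /\ p = \sum_(cg <- s) cg.1 * cg.2.

Definition ideal_ext (R S : comNzRingType) (f : R -> S) (I : R -> Prop) :
    S -> Prop :=
  ideal_gen (fun q => exists2 p, I p & q = f p).

(* Degree reverse lexicographic order, x_1 > ... > x_n.  The order that the
   multinomials library puts on 'X_{1..n} (and hence mlead) is called degrevlex
   in its header, but mnmc_le compares exponents lexicographically from the
   first variable, so it cannot be used here. *)
Definition degrevlex_lt (n : nat) (u v : 'X_{1..n}) : bool :=
  (mdeg u < mdeg v)%N ||
  (mdeg u == mdeg v) &&
    [exists i : 'I_n, (v i < u i)%N && [forall j : 'I_n, (i < j)%N ==> (u j == v j)]].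

Section GenericInitialIdeal.
Variables (K : fieldType) (n : nat).
Implicit Types (I J : {mpoly K[n]} -> Prop).

Definition initial_monomial (p : {mpoly K[n]}) (u : 'X_{1..n}) : Prop :=
  u \in msupp p /\ forall v, v \in msupp p -> v != u -> degrevlex_lt v u.

Definition initial_ideal I : {mpoly K[n]} -> Prop :=
  ideal_gen (fun q => exists p u, [/\ I p, initial_monomial p u & q = 'X_[u]]).

Definition linear_change (g : 'M[K]_n) (p : {mpoly K[n]}) : {mpoly K[n]} :=
  p \mPo [tuple \sum_(j < n) g i j *: 'X_j | i < n].

Definition ideal_change (g : 'M[K]_n) I (q : {mpoly K[n]}) : Prop :=
  exists2 p, I p & q = linear_change g p.

Definition zariski_open_GL (O : 'M[K]_n -> Prop) : Prop :=
  exists S : {mpoly K[n * n]} -> Prop, forall g : 'M[K]_n,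
    O g <-> g \in unitmx /\ exists2 f, S f & f.@[mxvec g 0] != 0.

(* The generic initial ideal over an infinite field: J = in(g I) for all g in
   a nonempty Zariski open subset of GL_n(K). *)
Definition generic_initial I J : Prop :=
  exists O : 'M[K]_n -> Prop,
    [/\ zariski_open_GL O,
        exists g, O g
      & forall g, O g -> forall p, initial_ideal (ideal_change g I) p <-> J p].

End GenericInitialIdeal.

Definition infinite_type (T : eqType) : Prop := forall s : seq T, exists x, x \notin s.

Definition scalar_ext (K L : fieldType) (iota : {rmorphism K -> L}) (n : nat)
    (I : {mpoly K[n]} -> Prop) : {mpoly L[n]} -> Prop :=
  ideal_ext (map_mpoly iota) I.

(* gin(I) = J; over a finite field the ideals are first extended to an
   infinite extension field. *)
Definition is_gin (K : fieldType) (n : nat) (I J : {mpoly K[n]} -> Prop) : Prop :=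
  (infinite_type K -> generic_initial I J) /\
  (~ infinite_type K ->
   forall (L : fieldType) (iota : {rmorphism K -> L}), infinite_type L ->
     generic_initial (scalar_ext iota I) (scalar_ext iota J)).

Section OrderIdeals.
Variable m : nat.
Implicit Type U : {fset 'X_{1..m}}.
Local Open Scope multi_scope.

Definition order_ideal U : Prop :=
  [/\ forall u v : 'X_{1..m}, u \in U -> (v <= u)%MM -> v \in U,
      0%MM \in U
    & forall i : 'I_m, U_(i)%MM \in U].

Definition shifted U : Prop :=
  forall (u : 'X_{1..m}) (i j : 'I_m), (i < j)%N ->
    (U_(i) + u)%MM \in U -> (U_(j) + u)%MM \in U.

Definition dmax U : nat := (\max_(u <- U) mdeg u)%N.

Definition order_ideal_compl (K : fieldType) U : {mpoly K[m]} -> Prop :=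
  ideal_gen (fun q => exists2 u, u \notin U & q = 'X_[u]).

(* The sequence i_1 <= ... <= i_s of 1-based indices with u = x_(i_1)...x_(i_s). *)
Definition indices (u : 'X_{1..m}) : seq nat :=
  flatten [seq nseq (u i) i.+1 | i <- enum 'I_m].

(* The 1-based elements of F_t(u) for d = dmax U; [a, b] is index_iota a b.+1. *)
Definition facet_seq (t d : nat) (u : 'X_{1..m}) : seq nat :=
  let s := mdeg u in
  let i l := nth 0%N (indices u) l.-1 in
  let pairs r :=
    flatten [seq [:: i l + 2 * (l - 1); i l + 2 * l - 1]%N | l <- index_iota 1 r.+1] in
  if (s <= t)%N then
    pairs s ++ index_iota (m + 2 * s + 1) (m + t + d).+1
  else
    pairs t ++ [seq (i l + l + t - 1)%N | l <- index_iota t.+1 s.+1]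
      ++ index_iota (m + t + s + 1) (m + t + d).+1.

Definition facet (t d : nat) (u : 'X_{1..m}) : {set 'I_(m + t + d)} :=
  [set k : 'I_(m + t + d) | k.+1 \in facet_seq t d u].

Definition squeezed (t : nat) U : {set {set 'I_(m + t + dmax U)}} :=
  [set F : {set 'I_(m + t + dmax U)} | has (fun u => F \subset facet t (dmax U) u) U].

End OrderIdeals.

Definition stanley_reisner (K : fieldType) (n : nat) (D : {set {set 'I_n}}) :
    {mpoly K[n]} -> Prop :=
  ideal_gen (fun q => exists2 F : {set 'I_n}, F \notin D & q = \prod_(i in F) 'X_i).

Arguments order_ideal_compl {m} K U p.
Arguments stanley_reisner K {n} D p.

(* The inclusion P(m) -> P(m + t + d), x_i |-> x_i. *)
Definition poly_incl (K : fieldType) (m t d : nat) (p : {mpoly K[m]}) :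
    {mpoly K[m + t + d]} :=
  p \mPo [tuple 'X_(lshift d (lshift t i)) | i < m].

(* Main.v *)
Require Import Defs.
From HB Require Import structures.
From mathcomp Require Import all_boot all_order all_algebra.
From mathcomp Require Import finmap.
From mathcomp Require Import zify ring.
From mathcomp Require Import freeg mpoly.

Set Implicit Arguments.
Unset Strict Implicit.
Unset Printing Implicit Defensive.

Import GRing.Theory.
Local Open Scope ring_scope.

(** Write n = m + t + d, let L_b = sum_j g_(b,j) x_j be the image of x_b under a
matrix g, and let I be the image of the Stanley-Reisner ideal.  The open set is
that of the invertible g in general position: every minor on arbitrary rows and
the first columns is nonzero.  Over an infinite field the Vandermonde matrices
belong to it.  For such g, in every characteristic, in(I) is the extension of
I(U), for the following two reasons.

Every monomial outside U lies in in(I).  Put e(l) = l + min(l, t), and call an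
increasing sequence a spaced if a_(l+1) > a_l + 1 for the first t gaps.  If
x_(s_0)...x_(s_(k-1)), with s nondecreasing, is not in U, then every spaced a
with a_l <= s_l + e(l) is a nonface (spaced_nonface), so the products of the
corresponding L_(a_l) lie in I.  Their linear span contains a form with initial
monomial x_(s_0)...x_(s_(k-1)) (leading_form).  This goes by induction on k:
with i the last letter of s and s' the rest, the span for s contains, modulo
(x_j : j > i), every linear form times the span for s' (multiply_straighten).
Indeed, for a fixed spaced a bounded by s', multiplication by L_b raises a
problem only when b is in a or is the successor of one of the first t entries of
a.  This leaves at least i + 1 indices b in the range, and any i + 1 of the
forms L_b span all linear forms modulo (x_j : j > i).  When a with b inserted is
still not spaced, b + 1 is an entry of a, and moving this entry down to b gives
the same product from a smaller spaced sequence.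

No initial monomial of I has its part in x_1, ..., x_m in U.  By the first half,
the monomials u of U span P(n)/I over A = K[x_(m+1), ..., x_n].  Each facet F
gives an A-algebra map phi_F from P(n) to A that kills L_i exactly when i is not
in F, hence kills I (coordinate_subspace).  The facets are pairwise distinct and
there are as many of them as elements of U (facet_inj), so the matrix
(phi_F(u)) is square.  Multiplied by the matrix that expresses the products of
the L_i, i in F, in terms of U it becomes diagonal with nonzero entries, so its
determinant is nonzero, and U is A-free modulo I (standard_free).  This rank
argument replaces a computation of Hilbert functions. *)

(** * Facets as increasing sequences *)

Section Facets.
Local Open Scope nat_scope.
Variable t : nat.

(** A facet is made of blocks: [t] pairs of consecutive vertices, then single
vertices.  The offset of [l] is the number of vertices in the blocks before
block [l]. *)
Definition offset l := l + minn l t.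

(** The index of the block that contains the vertex in position [q]; it is the
left inverse and the adjoint of the offset. *)
Definition block q := maxn q./2 (q - t).

Lemma block_offset l : block (offset l) = l.
Proof. by rewrite /block /offset; lia. Qed.

Lemma block_offsetS l : l < t -> block (offset l).+1 = l.
Proof. by rewrite /block /offset; lia. Qed.

Lemma leq_block l q : (l <= block q) = (offset l <= q).
Proof. by rewrite /block /offset; lia. Qed.

Lemma block_mono q r : q <= r -> block q <= block r.
Proof. by rewrite /block; lia. Qed.

Lemma offset_mono k l : k <= l -> offset k <= offset l.
Proof. by rewrite /offset; lia. Qed.

Variable m : nat.
Implicit Types u v : 'X_{1..m}.

Definition word u : seq nat :=
  flatten [seq nseq (u i) (i : nat) | i <- enum 'I_m].

Lemma indicesE u : indices u = [seq i.+1 | i <- word u].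
Proof.
rewrite /indices /word map_flatten -map_comp; congr flatten.
by apply: eq_map => i /=; rewrite map_nseq.
Qed.

Lemma size_word u : size (word u) = mdeg u.
Proof.
rewrite size_flatten /shape -map_comp mdegE sumnE big_map big_enum /=.
by apply: eq_bigr => i _; rewrite size_nseq.
Qed.

Lemma mem_word u x : x \in word u -> x < m.
Proof. by case/flatten_mapP => i _; rewrite mem_nseq => /andP[_ /eqP->]. Qed.

Lemma sorted_word u : sorted leq (word u).
Proof.
rewrite /word; have: sorted ltn [seq val i | i <- enum 'I_m].
  by rewrite val_enum_ord iota_ltn_sorted.
rewrite !(sorted_pairwise leq_trans) (sorted_pairwise ltn_trans) pairwise_map.
elim: (enum 'I_m) => //= i s IH /andP[/allP lt_i_s /IH{}IH].
rewrite pairwise_cat IH andbT; apply/andP; split.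
  apply/allrelP => x y; rewrite mem_nseq => /andP[_ /eqP->].
  by case/flatten_mapP => j /lt_i_s /= ltij; rewrite mem_nseq => /andP[_ /eqP->]; apply: ltnW.
elim: (u i) => //= n ->; rewrite andbT; apply/allP => x.
by rewrite mem_nseq => /andP[_ /eqP->].
Qed.

Definition mono_of (s : seq nat) : 'X_{1..m} := [multinom count_mem (i : nat) s | i < m].

Lemma mono_of_word u : mono_of (word u) = u.
Proof.
apply/mnmP => i; rewrite mnmE /word count_flatten -map_comp sumnE big_map big_enum /=.
rewrite (bigD1 i) //= count_nseq /= eqxx mul1n big1 ?addn0 // => j neq_ji.
by rewrite count_nseq /= (_ : (_ == _) = false) //; apply/negbTE/eqP => /val_inj eqij; case/eqP: neq_ji.
Qed.

(** The three shapes of vertices in a facet -- pairs, singles and the final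
interval -- are given by one formula, with the default value [m] standing for the
missing letters of the word of [u].  It makes the enumeration strictly increasing
by inspection, so that the cardinality and the injectivity of the facet map
become statements about sequences. *)
Definition enum_facet u q := q + nth m (word u) (block q).

Lemma nth_word_le u l : nth m (word u) l <= m.
Proof.
have [l_lt | l_ge] := ltnP l (size (word u)); last by rewrite nth_default.
exact/ltnW/(mem_word (mem_nth m l_lt)).
Qed.

Lemma nth_word_mono u k l : k <= l -> nth m (word u) k <= nth m (word u) l.
Proof.
move=> le_kl; have [l_lt | l_ge] := ltnP l (size (word u)).
  by apply: (sorted_leq_nth leq_trans leqnn) => //; rewrite ?inE //; [exact: sorted_word| lia].
by rewrite [leqRHS]nth_default // nth_word_le.
Qed.

Lemma enum_facet_lt u q r : q < r -> enum_facet u q < enum_facet u r.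
Proof.
by move=> lt_qr; rewrite -addSn leq_add // nth_word_mono // block_mono // ltnW.
Qed.

Lemma pairs_enum_facet u r : r <= mdeg u -> r <= t ->
  flatten [seq [:: nth 0 (indices u) l.-1 + 2 * (l - 1);
                   nth 0 (indices u) l.-1 + 2 * l - 1] | l <- index_iota 1 r.+1]
  = [seq (enum_facet u q).+1 | q <- iota 0 (2 * r)].
Proof.
elim: r => [|r IH] // lt_r_u lt_r_t.
rewrite (_ : 2 * r.+1 = (2 * r).+2); last lia.
have -> : index_iota 1 r.+2 = index_iota 1 r.+1 ++ [:: r.+1].
  by rewrite /index_iota !subSS !subn0 -[X in iota _ X]addn1 iotaD.
rewrite map_cat flatten_cat.
rewrite [X in X ++ _]IH ?(ltnW lt_r_u) ?(ltnW lt_r_t) //.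
rewrite -[in RHS]addn2 iotaD map_cat /=; congr (_ ++ _).
rewrite indicesE (nth_map m) /= ?size_word //.
have -> : enum_facet u (2 * r) = 2 * r + nth m (word u) r.
  by congr (_ + nth _ _ _); rewrite /block; lia.
have -> : enum_facet u (2 * r).+1 = (2 * r).+1 + nth m (word u) r.
  by congr (_ + nth _ _ _); rewrite /block; lia.
by congr [:: _; _]; lia.
Qed.

Lemma tail_enum_facet u (d : nat) : mdeg u <= d ->
  index_iota (m + offset (mdeg u) + 1) (m + t + d).+1
  = [seq (enum_facet u q).+1 | q <- iota (offset (mdeg u)) (t + d - offset (mdeg u))].
Proof.
move=> le_u_d; rewrite /index_iota (_ : _ - _ = t + d - offset (mdeg u)); last first.
  by rewrite /offset; lia.
rewrite addn1 -addSn iotaDl; apply/eq_in_map => q.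
rewrite mem_iota => /andP[le_q _]; rewrite /enum_facet nth_default ?size_word ?leq_block //; lia.
Qed.

Lemma facet_seqE u d : mdeg u <= d ->
  facet_seq t d u = [seq (enum_facet u q).+1 | q <- iota 0 (t + d)].
Proof.
move=> le_u_d; rewrite /facet_seq; case: leqP => [le_u_t | lt_t_u].
  rewrite pairs_enum_facet // (_ : m + 2 * _ + 1 = m + offset (mdeg u) + 1); last first.
    by rewrite /offset; lia.
  rewrite tail_enum_facet // -map_cat (_ : 2 * _ = offset (mdeg u)); last first.
    by rewrite /offset; lia.
  by rewrite -iotaD; congr [seq _ | _ <- iota 0 _]; rewrite /offset; lia.
rewrite pairs_enum_facet ?(ltnW lt_t_u) //.
rewrite (_ : m + t + mdeg u + 1 = m + offset (mdeg u) + 1); last first.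
  by rewrite /offset; lia.
rewrite tail_enum_facet //.
have -> : [seq nth 0 (indices u) l.-1 + l + t - 1 | l <- index_iota t.+1 (mdeg u).+1]
   = [seq (enum_facet u q).+1 | q <- iota (2 * t) (mdeg u - t)].
  rewrite /index_iota subSS -(add1n t) iotaDl (_ : 2 * t = t + t); last lia.
  rewrite iotaDl -!map_comp; apply/eq_in_map => l; rewrite mem_iota => /andP[le_l lt_l] /=.
  rewrite indicesE (nth_map m) ?size_word; last lia.
  rewrite /enum_facet (_ : block _ = l); last by rewrite /block; lia. rewrite add0n; lia.
rewrite catA -!map_cat -iotaD (_ : offset _ = 0 + (2 * t + (mdeg u - t))); last first.
  by rewrite /offset; lia.
by rewrite -iotaD; congr [seq _ | _ <- iota 0 _]; lia.
Qed.

Lemma mem_facet u d (k : 'I_(m + t + d)) : mdeg u <= d ->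
  (k \in facet t d u) = ((k : nat) \in [seq enum_facet u q | q <- iota 0 (t + d)]).
Proof.
move=> le_u_d; rewrite inE facet_seqE //.
by rewrite -(mem_map succn_inj [seq enum_facet u q | q <- _]) -map_comp.
Qed.

Lemma enum_facet_bound u d q : q < t + d -> enum_facet u q < m + t + d.
Proof. by move=> lt_q; have := nth_word_le u (block q); rewrite /enum_facet; lia. Qed.

Lemma sorted_enum_facet u N : sorted ltn [seq enum_facet u q | q <- iota 0 N].
Proof.
by apply: (homo_sorted (@enum_facet_lt u)); apply: iota_ltn_sorted.
Qed.

Lemma facet_image u d : mdeg u <= d ->
  perm_eq [seq val k | k <- enum (facet t d u)] [seq enum_facet u q | q <- iota 0 (t + d)].
Proof.
move=> le_u_d; apply: uniq_perm.
- by rewrite (map_inj_uniq val_inj) enum_uniq.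
- by apply: (sorted_uniq ltn_trans ltnn); apply: sorted_enum_facet.
move=> x; apply/mapP/idP => [[k] | x_in].
  by rewrite mem_enum mem_facet // => ? ->.
have lt_x : x < m + t + d.
  by case/mapP: x_in => q; rewrite mem_iota => /andP[_ lt_q] ->; apply: enum_facet_bound.
by exists (Ordinal lt_x); rewrite // mem_enum mem_facet.
Qed.

Lemma card_facet u d : mdeg u <= d -> #|facet t d u| = t + d.
Proof.
by move=> le_u_d; rewrite cardE -(size_map val) (perm_size (facet_image le_u_d)) size_map size_iota.
Qed.

(** The letter [l] of the word can be read off at position [offset l] of the
increasing enumeration. *)
Lemma facet_inj u v d : mdeg u <= d -> mdeg v <= d ->
  facet t d u = facet t d v -> u = v.
Proof.
move=> le_u_d le_v_d eqF.
have eq_enum : [seq enum_facet u q | q <- iota 0 (t + d)] = [seq enum_facet v q | q <- iota 0 (t + d)].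
  apply: (irr_sorted_eq ltn_trans ltnn); try exact: sorted_enum_facet.
  apply: perm_mem; apply: perm_trans (facet_image le_v_d).
  by rewrite perm_sym -eqF facet_image.
have eq_nth l : nth m (word u) l = nth m (word v) l.
  have [lt_l_d | le_d_l] := ltnP l d; last by rewrite !nth_default ?size_word //; lia.
  have lt_off : offset l < t + d by rewrite /offset; lia.
  have := congr1 (nth 0 ^~ (offset l)) eq_enum.
  rewrite !(nth_map 0) ?size_iota // nth_iota // add0n /enum_facet block_offset.
  exact: addnI.
have le_size x y : (forall l, nth m (word x) l = nth m (word y) l) -> size (word x) <= size (word y).
  move=> eq_xy; rewrite leqNgt; apply/negP => lt_s.
  have := mem_word (mem_nth m lt_s); rewrite eq_xy nth_default //.
  by rewrite ltnn.
rewrite -(mono_of_word u) -(mono_of_word v); congr mono_of.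
apply: (@eq_from_nth _ m) => [|l _]; last exact: eq_nth.
by apply/eqP; rewrite eqn_leq !le_size.
Qed.

(** * Spaced sequences and nonfaces *)

(** The first [k] gaps have to leave out at least one integer; [x] is the entry
that precedes the sequence. *)
Fixpoint spaced_from k x (a : seq nat) :=
  if a is y :: a' then (x + (0 < k) < y) && spaced_from k.-1 y a' else true.

Definition spaced k (a : seq nat) := if a is x :: a' then spaced_from k x a' else true.

Lemma spaced_nth k a l : spaced k a -> l.+1 < size a -> nth 0 a l + (l < k) < nth 0 a l.+1.
Proof.
case: a => // x a /=; elim: a k x l => // y a IH k x [|l] /= /andP[lt_xy sp_y] lt_l //.
by have := IH _ _ l sp_y; rewrite /= ltn_predRL; apply.
Qed.

Lemma spaced_sorted k a : spaced k a -> sorted ltn a.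
Proof.
case: a => //= x a; elim: a k x => //= y a IH k x /andP[lt_xy /IH->].
by rewrite andbT (leq_ltn_trans _ lt_xy) // leq_addr.
Qed.

(** The largest vertices that the spaced sequences attached to the word [s] may
use; a spaced sequence equal to its bounds encodes [s] itself. *)
Definition bounds (s : seq nat) := [seq nth 0 s l + offset l | l <- iota 0 (size s)].

Definition bounded_by (s a : seq nat) := all2 leq a (bounds s).

Lemma bounded_byP s a : bounded_by s a ->
  size a = size s /\ forall l, l < size s -> nth 0 a l <= nth 0 s l + offset l.
Proof.
rewrite /bounded_by => bd_a; have eq_sz : size a = size s.
  by move: bd_a; rewrite all2E size_map size_iota => /andP[/eqP].
split=> // l lt_l.
rewrite -[leqRHS](_ : nth 0 (bounds s) l = _); last first.
  by rewrite (nth_map 0) ?size_iota // nth_iota.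
move: eq_sz lt_l => <-; elim: a (bounds s) bd_a l => [|x a IH] [|y w] //= /andP[le_xy le_aw] [|l] //.
exact: IH.
Qed.

Lemma bounds_rcons s i : bounds (rcons s i) = rcons (bounds s) (i + offset (size s)).
Proof.
rewrite /bounds size_rcons -[in iota _ _]addn1 iotaD map_cat /= cats1.
rewrite nth_rcons ltnn eqxx; congr rcons; apply/eq_in_map => l.
by rewrite mem_iota nth_rcons /= => ->.
Qed.

Lemma sorted_bounds s : sorted leq s -> sorted leq (bounds s).
Proof.
move=> s_sorted; apply: (homo_sorted_in (P := mem (iota 0 (size s))) (e := leq)).
- move=> k l; rewrite !mem_iota /= => lt_k lt_l le_kl; rewrite leq_add ?offset_mono //.
  exact: (sorted_leq_nth leq_trans leqnn).
- exact/allP.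
- exact: iota_sorted.
Qed.

Fixpoint insert b (a : seq nat) :=
  if a is x :: a' then if b < x then b :: a else x :: insert b a' else [:: b].

Lemma perm_insert b a : perm_eq (insert b a) (b :: a).
Proof.
elim: a => //= x a IH; case: ifP => // _.
by rewrite perm_sym (perm_catCA [:: b] [:: x] a) /= perm_cons perm_sym.
Qed.

(** Insertion shifts the entries above [b] by one position, where the bounds are
larger. *)
Lemma all2_leq_insert w B b a : sorted leq (rcons w B) -> b <= B ->
  all2 leq a w -> all2 leq (insert b a) (rcons w B).
Proof.
have shift y x : forall a w, path leq y (rcons w B) -> x <= y -> all2 leq a w ->
    all2 leq (x :: a) (rcons w B).
  move=> {}a {}w; elim: w y x a => [|z w IH] y x [|x' a] //=.
    by rewrite !andbT => le_yB le_xy _; apply: leq_trans le_yB.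
  move=> /andP[le_yz pw] le_xy /andP[le_xz le_aw]; rewrite (leq_trans le_xy) //=.
  exact: IH pw _ le_aw.
elim: a w => [|x a IH] [|y w] //= sw le_bB; first by rewrite le_bB.
move=> /andP[le_xy le_aw]; case: ifP => [lt_bx|_] /=.
  by rewrite (leq_trans (ltnW lt_bx) le_xy) /=; apply: shift sw le_xy le_aw.
by rewrite le_xy IH //; apply: path_sorted sw.
Qed.

Lemma spaced_from_weak j k x y a : j <= k -> y <= x -> spaced_from k x a -> spaced_from j y a.
Proof.
elim: a j k x y => //= z a IH j k x y le_jk le_yx /andP[lt_xz sp_z].
by rewrite (IH _ k.-1 z z) ?andbT //; lia.
Qed.

(** If [b] is neither an entry nor the successor of an entry followed by a wide
gap, the only obstruction to inserting [b] is that [b.+1] is an entry that would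
have to stay away from [b]; then that entry can be lowered to [b]. *)
Lemma spaced_from_insert k x a b : spaced_from k x a -> x + (0 < k) < b ->
    b \notin a -> b \notin [seq y.+1 | y <- take k.-1 a] ->
  spaced_from k x (insert b a) \/
  exists a1 a2, a = a1 ++ b.+1 :: a2 /\ spaced_from k x (a1 ++ b :: a2).
Proof.
elim: a k x => [|y a IH] k x /=; first by move=> _ ->; left.
move=> /andP[lt_xy sp_y] lt_xb; rewrite inE negb_or => /andP[neq_by b_a] b_S.
case: ifP => [lt_by | le_yb] /=.
  have [gap | no_gap] := ltnP (b + (0 < k.-1)) y.
    by left; rewrite lt_xb /=; apply: spaced_from_weak sp_y; lia.
  right; exists [::], a; split; first by congr (_ :: _); lia.
  by rewrite /= lt_xb; apply: spaced_from_weak sp_y; rewrite // ltnW.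
have lt_yb : y + (0 < k.-1) < b.
  by move: b_S; case: (k.-1) => [|k'] /=; rewrite ?inE ?negb_or; lia.
have b_S' : b \notin [seq y0.+1 | y0 <- take k.-2 a].
  by case: (k.-1) b_S => [|j] /=; rewrite ?take0 // inE negb_or => /andP[].
have [sp | [a1 [a2 [-> sp]]]] := IH _ _ sp_y lt_yb b_a b_S'.
  by left; rewrite lt_xy.
by right; exists (y :: a1), a2; rewrite /= lt_xy.
Qed.

Lemma spaced_insert k a b : spaced k a ->
    b \notin a -> b \notin [seq y.+1 | y <- take k a] ->
  spaced k (insert b a) \/
  exists a1 a2, a = a1 ++ b.+1 :: a2 /\ spaced k (a1 ++ b :: a2).
Proof.
case: a => [|x a] /=; first by left.
move=> sp_x; rewrite inE negb_or => /andP[neq_bx b_a] b_S.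
case: ifP => [lt_bx | le_xb] /=.
  have [gap | no_gap] := ltnP (b + (0 < k)) x.
    by left; apply: spaced_from_weak sp_x; lia.
  right; exists [::], a; split; first by congr (_ :: _); lia.
  by apply: spaced_from_weak sp_x; rewrite // ltnW.
have lt_xb : x + (0 < k) < b.
  by move: b_S; case: (k) => [|k'] /=; rewrite ?inE ?negb_or; lia.
have b_S' : b \notin [seq y.+1 | y <- take k.-1 a].
  by case: (k) b_S => [|j] /=; rewrite ?take0 // inE negb_or => /andP[].
have [sp | [a1 [a2 [-> sp]]]] := spaced_from_insert sp_x lt_xb b_a b_S'.
  by left.
by right; exists (x :: a1), a2.
Qed.

(** The indices that cannot be inserted in [a], even up to an exchange. *)
Definition blocked (a : seq nat) := a ++ [seq y.+1 | y <- take t a].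

Lemma size_blocked a : size (blocked a) = offset (size a).
Proof. by rewrite size_cat size_map size_take_min minnC. Qed.

(** The bound on the last letter grows exactly as fast as the number of blocked
indices, so that the number of admissible indices does not depend on the degree. *)
Lemma size_unblocked a N :
  N <= size [seq b <- iota 0 (N + offset (size a)) | b \notin blocked a].
Proof.
set r := iota _ _; rewrite size_filter.
have : count (mem (blocked a)) r <= size (blocked a).
  rewrite -size_filter; apply: uniq_leq_size; first by rewrite filter_uniq ?iota_uniq.
  by move=> x; rewrite mem_filter => /andP[].
rewrite size_blocked => le_blocked.
rewrite -(leq_add2r (count (mem (blocked a)) r)) [leqRHS]addnC.
by rewrite (count_predC (mem (blocked a))) size_iota leq_add2l.
Qed.

(** A spaced sequence meets each pair of a facet at most once, so its entry [l]
lies in block [l] or in a later one. *)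
Lemma spaced_in_facet u a N :
    spaced t a -> all (mem [seq enum_facet u q | q <- iota 0 N]) a ->
  forall l, l < size a -> enum_facet u (offset l) <= nth 0 a l.
Proof.
move=> sp_a /allP a_sub.
have pos l : l < size a -> exists q, nth 0 a l = enum_facet u q.
  by move=> lt_l; have /mapP[q _ ->] := a_sub _ (mem_nth 0 lt_l); exists q.
suff block_ge l : l < size a -> exists2 q, nth 0 a l = enum_facet u q & offset l <= q.
  move=> l /block_ge[q -> le_q]; case: ltngtP le_q => // [lt_q|<-] _ //.
  exact/ltnW/enum_facet_lt.
elim: l => [|l IH] lt_l; first by have [q ->] := pos _ lt_l; exists q; rewrite // /offset min0n.
have [q eq_q le_q] := IH (ltnW lt_l); have [r eq_r] := pos _ lt_l.
have := spaced_nth sp_a lt_l; rewrite eq_q eq_r => lt_qr.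
have lt_q_r : q < r.
  rewrite ltnNge; apply/negP; rewrite leq_eqVlt => /orP[/eqP eq_rq|]; last first.
    by move=> /(enum_facet_lt u); lia.
  by move: lt_qr; rewrite eq_rq; lia.
exists r => //; have [le_t_l|lt_l_t] := leqP t l.
  by move: le_q; rewrite /offset; lia.
have [|r_lt] := leqP (offset l.+1) r => //; exfalso.
have eqs : q = offset l /\ r = (offset l).+1 by move: le_q r_lt; rewrite /offset; lia.
move: lt_qr; rewrite lt_l_t /enum_facet eqs.1 eqs.2 block_offset block_offsetS //.
by lia.
Qed.

Variable U : {fset 'X_{1..m}}.
Hypotheses (hU : order_ideal U) (hS : shifted U).

Lemma mono_of_cons i s : mono_of (i :: s) = (mono_of [:: i] + mono_of s)%MM.
Proof. by apply/mnmP => j; rewrite mnmDE !mnmE /= addn0. Qed.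

Lemma mono_of_ord (i : 'I_m) : mono_of [:: i : nat] = U_(i)%MM.
Proof. by apply/mnmP => j; rewrite mnmE mnm1E /= addn0. Qed.

Lemma shifted_le r i j : i <= j -> j < m ->
  mono_of (i :: r) \in U -> mono_of (j :: r) \in U.
Proof.
rewrite leq_eqVlt => /orP[/eqP-> //|lt_ij] lt_jm.
rewrite mono_of_cons [in X in _ -> X]mono_of_cons.
have -> : mono_of [:: j] = U_(Ordinal lt_jm)%MM by rewrite -mono_of_ord.
have lt_im := ltn_trans lt_ij lt_jm.
have -> : mono_of [:: i] = U_(Ordinal lt_im)%MM by rewrite -mono_of_ord.
exact: (hS (i := Ordinal lt_im) (j := Ordinal lt_jm)).
Qed.

(** The tail [r] collects the letters already replaced, which makes the induction
replace one letter at a time. *)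
Lemma shifted_dominate (a b r : seq nat) :
    size a = size b -> all2 leq a b -> all (gtn m) b ->
  mono_of (a ++ r) \in U -> mono_of (b ++ r) \in U.
Proof.
elim: a b r => [|x a IH] [|y b] r //= [eq_s] /andP[le_xy le_ab] /andP[lt_y lt_b] in_U.
have {}in_U : mono_of (y :: a ++ r) \in U by apply: shifted_le in_U.
rewrite (_ : mono_of _ = mono_of (b ++ y :: r)).
  apply: IH => //; rewrite (_ : mono_of _ = mono_of (y :: a ++ r)) //.
  apply/mnmP => j.
  by rewrite !mnmE /= !count_cat /=; lia.
by apply/mnmP => j; rewrite !mnmE /= !count_cat /=; lia.
Qed.

(** If [F] were contained in the facet of [u], comparing blocks would bound the
first letters of [u] by those of [s], and then [s] would be obtained from a
divisor of [u] by raising letters. *)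
Lemma spaced_nonface (s a : seq nat) (F : {set 'I_(m + t + dmax U)}) :
    all (gtn m) s -> mono_of s \notin U ->
    spaced t a -> bounded_by s a -> (forall x, x \in a -> exists2 k, k \in F & x = val k) ->
  F \notin squeezed t U.
Proof.
move=> s_lt s_notin sp_a s_bd a_sub; apply: contra s_notin.
have [eq_sz a_le] := bounded_byP s_bd.
rewrite inE => /hasP[u u_in /subsetP F_sub].
have le_u_d : mdeg u <= dmax U by apply: leq_bigmax_seq.
have a_ge : forall l, l < size a -> enum_facet u (offset l) <= nth 0 a l.
  apply: (@spaced_in_facet u a (t + dmax U) sp_a); apply/allP => x /a_sub[k k_in ->].
  by rewrite /= -mem_facet // F_sub.
have nth_le l : l < size s -> nth m (word u) l <= nth 0 s l.
  move=> lt_l; have := a_ge l; rewrite eq_sz /enum_facet block_offset => /(_ lt_l).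
  by have := a_le l lt_l; lia.
have le_s_u : size s <= size (word u).
  rewrite leqNgt; apply/negP => lt_u_s; have := nth_le _ lt_u_s; rewrite nth_default // leqNgt.
  by move=> /negP; apply; apply: (allP s_lt); apply: mem_nth.
rewrite -[s]cats0; apply: (shifted_dominate (a := take (size s) (word u))) => //.
- by rewrite size_takel.
- elim: {s_lt s_bd eq_sz a_le} s (word u) nth_le le_s_u => [|y s IH] [|x w] //= nth_le le_s.
  by rewrite (nth_le 0) //= IH // => l; apply: (nth_le l.+1).
- case: hU => U_dvd _ _; apply: U_dvd u_in _; apply/mnm_lepP => i.
  rewrite -[u in leqRHS]mono_of_word !mnmE cats0 -[in leqRHS](cat_take_drop (size s) (word u)).
  by rewrite count_cat leq_addr.
Qed.

End Facets.

(** * The degree reverse lexicographic order *)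
Section Order.
Variable n : nat.
Implicit Types u v w : 'X_{1..n}.

Definition revlex_lt v u :=
  [exists i : 'I_n, (u i < v i)%N && [forall j : 'I_n, (i < j)%N ==> (v j == u j)]].

Lemma revlex_lt_add w v u : revlex_lt (w + v)%MM (w + u)%MM = revlex_lt v u.
Proof.
apply: eq_existsb => i; rewrite !mnmDE ltn_add2l; congr (_ && _).
by apply: eq_forallb => j; rewrite !mnmDE eqn_add2l.
Qed.

Lemma revlex_lt_tail (i j : 'I_n) v u : (i < j)%N -> v j != 0%N ->
  (forall k : 'I_n, (i < k)%N -> u k = 0%N) -> revlex_lt v u.
Proof.
move=> lt_ij v_j u0; have [k] := @arg_maxnP _ j (fun k => v k != 0%N) val v_j.
move=> v_k max_k; apply/existsP; exists k; have le_jk := max_k j v_j.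
rewrite u0 ?lt0n ?v_k ?(leq_trans lt_ij) //=; apply/forallP => h; apply/implyP => lt_kh.
rewrite (u0 h); last by apply: leq_trans (ltnW lt_kh); apply: leq_trans lt_ij le_jk.
by apply: contraTT lt_kh => /max_k; rewrite -leqNgt.
Qed.

Lemma revlex_lt_irr v : revlex_lt v v = false.
Proof. by apply/existsP => -[i]; rewrite ltnn. Qed.

Lemma revlex_lt_trans v u w : revlex_lt u v -> revlex_lt v w -> revlex_lt u w.
Proof.
move=> /existsP[i /andP[lt_i /forallP eq_i]] /existsP[j /andP[lt_j /forallP eq_j]].
have {}eq_i (k : 'I_n) : (i < k)%N -> u k = v k by move=> lt_ik; apply/eqP/(implyP (eq_i k)).
have {}eq_j (k : 'I_n) : (j < k)%N -> v k = w k by move=> lt_jk; apply/eqP/(implyP (eq_j k)).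
apply/existsP; case: (ltngtP i j) => [lt_ij|lt_ji|/val_inj eq_ij].
- exists j; rewrite (eq_i j) // lt_j; apply/forallP => k; apply/implyP => lt_jk.
  by rewrite eq_i ?eq_j // (ltn_trans lt_ij).
- exists i; rewrite -(eq_j i) // lt_i; apply/forallP => k; apply/implyP => lt_ik.
  by rewrite eq_i ?eq_j // (ltn_trans lt_ji).
- exists j; rewrite (ltn_trans lt_j) /= -?eq_ij //; apply/forallP => k; apply/implyP => lt_jk.
  by rewrite eq_i ?eq_j // -eq_ij.
Qed.

Lemma degrevlexE u v :
  degrevlex_lt u v = (mdeg u < mdeg v)%N || (mdeg u == mdeg v) && revlex_lt u v.
Proof. by []. Qed.

Lemma degrevlex_irr v : degrevlex_lt v v = false.
Proof. by rewrite degrevlexE ltnn revlex_lt_irr andbF. Qed.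

Lemma degrevlex_trans v u w : degrevlex_lt u v -> degrevlex_lt v w -> degrevlex_lt u w.
Proof.
rewrite !degrevlexE => /orP[lt_uv|/andP[/eqP-> rl_uv]] /orP[lt_vw|/andP[/eqP<- rl_vw]].
- by rewrite (ltn_trans lt_uv).
- by rewrite lt_uv.
- by rewrite lt_vw.
- by rewrite eqxx (revlex_lt_trans rl_uv) ?orbT.
Qed.

Lemma degrevlex_add w u v : degrevlex_lt (w + u)%MM (w + v)%MM = degrevlex_lt u v.
Proof. by rewrite !degrevlexE revlex_lt_add !mdegD ltn_add2l eqn_add2l. Qed.

Lemma degrevlex_mdeg u v : degrevlex_lt u v -> (mdeg u <= mdeg v)%N.
Proof. by case/orP => [/ltnW|/andP[/eqP->]]. Qed.

(** Only finitely many monomials lie below a given one, since the degree is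
compared first. *)
Lemma degrevlex_ind (Q : 'X_{1..n} -> Prop) :
  (forall v, (forall u, degrevlex_lt u v -> Q u) -> Q v) -> forall v, Q v.
Proof.
move=> step v.
pose below k w := [set x : 'X_{1..n < k} | degrevlex_lt x w].
suff below_ind k N w : (mdeg w < k)%N -> (#|below k w| < N)%N -> Q w.
  exact: (below_ind (mdeg v).+1 #|below (mdeg v).+1 v|.+1).
elim: N w => // N IH w lt_w lt_N; apply: step => u lt_uw.
have lt_u : (mdeg u < k)%N := leq_ltn_trans (degrevlex_mdeg lt_uw) lt_w.
rewrite ltnS in lt_N; apply: IH => //; apply: leq_trans lt_N; apply: proper_card; apply/properP; split.
  by apply/subsetP => x; rewrite !inE => /degrevlex_trans; apply.
by exists (BMultinom lt_u); rewrite !inE /= ?degrevlex_irr.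
Qed.

End Order.

(** * Products of linear forms in general position *)
Section GenericForms.
Variables (K : fieldType) (n : nat).
Local Notation P := {mpoly K[n]}.
Implicit Types (g : 'M[K]_n) (p q : P) (Z : P -> Prop).

Definition initial_minor (R : nzRingType) (A : 'M[R]_n) (k : 'I_n.+1) (f : 'I_k -> 'I_n) : R :=
  \det (\matrix_(r < k, c < k) A (f r) (widen_ord (ltn_ord k : (k <= n)%N) c)).

Definition general_position g :=
  forall (k : 'I_n.+1) (f : 'I_k -> 'I_n), injective f -> initial_minor g f != 0.

Definition row_form g (i : 'I_n) : P := \sum_(j < n) g i j *: 'X_j.

(** Indices are kept as natural numbers because the combinatorics of spaced
sequences is done in [nat]; the value [0] outside the range is harmless. *)
Definition nat_form g (b : nat) : P := if insub b is Some i then row_form g i else 0.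

Definition form_prod g (a : seq nat) : P := \prod_(b <- a) nat_form g b.

Definition linear_pred Z := Z 0 /\ forall c p q, Z p -> Z q -> Z (c *: p + q).

(** The ideal generated by the variables [x_j] with [j > i]. *)
Definition in_tail (i : 'I_n) p :=
  forall v, v \in msupp p -> exists2 j : 'I_n, (i < j)%N & v j != 0%N.

Lemma linear_in_tail i : linear_pred (in_tail i).
Proof.
split=> [v | c p q tl_p tl_q v]; first by rewrite msupp0.
move=> /msuppD_le; rewrite mem_cat => /orP[/msuppZ_le|]; [exact: tl_p | exact: tl_q].
Qed.

Lemma linear_pred_sum Z (I : eqType) (r : seq I) (c : I -> K) (F : I -> P) :
  linear_pred Z -> (forall x, x \in r -> Z (F x)) -> Z (\sum_(x <- r) c x *: F x).
Proof.
move=> [Z0 ZD]; elim: r => [|x r IH] F_Z; first by rewrite big_nil.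
rewrite big_cons; apply: ZD; first by apply: F_Z; rewrite mem_head.
by apply: IH => y y_r; apply: F_Z; rewrite in_cons y_r orbT.
Qed.

Lemma in_tailM i p q : in_tail i p -> in_tail i (p * q).
Proof.
move=> tl_p v /msuppM_le/allpairsP[[x y] /= [/tl_p[j lt_ij x_j] _ ->]].
by exists j => //; rewrite mnmDE addn_eq0 negb_and x_j.
Qed.

Lemma in_tailX (i j : 'I_n) : (i < j)%N -> in_tail i 'X_j.
Proof. by move=> lt_ij v /mem_msuppXP <-; exists j; rewrite // mnm1E eqxx. Qed.

Lemma in_tailD i p q : in_tail i p -> in_tail i q -> in_tail i (p + q).
Proof. by move=> tl_p tl_q; rewrite -[p]scale1r; apply: (linear_in_tail i).2. Qed.

(** The coefficients are found by inverting the square minor on [i + 1] of the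
chosen rows and the first [i + 1] columns.  Quantifying over a linear predicate
[Z] spares explicit linear combinations here and below. *)
Lemma span_mod_tail g (i : 'I_n) (bs : seq nat) (l : 'I_n -> K) Z :
    general_position g -> uniq bs -> all (gtn n) bs -> (i < size bs)%N ->
    linear_pred Z -> (forall b, b \in bs -> Z (nat_form g b)) ->
  exists2 q, Z q & in_tail i (\sum_(j < n) l j *: 'X_j - q).
Proof.
move=> g_good bs_uniq /allP bs_lt lt_i Zlin Zbs.
pose k : 'I_n.+1 := Ordinal (ltn_ord i : (i.+1 < n.+1)%N).
have bs_n (r : 'I_k) : (nth 0 bs r < n)%N.
  by apply: bs_lt; rewrite mem_nth //; apply: leq_ltn_trans lt_i; rewrite -ltnS.
pose f (r : 'I_k) := Ordinal (bs_n r).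
have f_inj : injective f.
  move=> r s /(congr1 val) /= /eqP; rewrite nth_uniq // => [/eqP/val_inj//||];
  by apply: leq_ltn_trans lt_i; rewrite -ltnS.
have := g_good k f f_inj; rewrite /initial_minor; set M := \matrix_(r, c) _ => detM.
pose w := @widen_ord k n (ltn_ord k).
pose c := (\row_j l (w j)) *m invmx M.
have cM : c *m M = \row_j l (w j) by rewrite mulmxKV // unitmxE unitfE.
exists (\sum_(r < k) c 0 r *: row_form g (f r)).
  apply: linear_pred_sum => // r _; have := Zbs (nth 0 bs r).
  rewrite /nat_form insubT => [|lt_r]; first exact: bs_n.
  rewrite (_ : Sub _ _ = f r); last exact: val_inj.
  by apply; rewrite mem_nth //; apply: leq_ltn_trans lt_i; rewrite -ltnS.
have -> : \sum_(r < k) c 0 r *: row_form g (f r) =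
          \sum_(j < n) (\sum_(r < k) c 0 r * g (f r) j) *: 'X_j.
  rewrite /row_form (eq_bigr (fun r => \sum_(j < n) (c 0 r * g (f r) j) *: 'X_j)); last first.
    by move=> r _; rewrite scaler_sumr; apply: eq_bigr => j _; rewrite scalerA.
  by rewrite exchange_big; apply: eq_bigr => j _; rewrite scaler_suml.
rewrite -sumrB (eq_bigr (fun j : 'I_n => (l j - \sum_(r < k) c 0 r * g (f r) j) *: 'X_j)); last first.
  by move=> j _; rewrite scalerBl.
have tl := linear_in_tail i; elim/big_ind: _ => [|p q|j _]; [exact: tl.1 | exact: in_tailD|].
have [lt_ij|le_ji] := ltnP i j.
  by rewrite -[_ *: _]addr0; apply: tl.2; [exact: in_tailX | exact: tl.1].
rewrite (_ : l j - _ = 0) ?scale0r; first exact: tl.1.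
have jw : j = w (Ordinal (le_ji : (j < k)%N)) by apply: val_inj.
have := congr1 (fun A : 'rV_k => A 0 (Ordinal (le_ji : (j < k)%N))) cM.
rewrite !mxE -jw => <-; apply/eqP; rewrite subr_eq0; apply/eqP; apply: eq_bigr => r _.
by rewrite [M _ _]mxE -/w -jw.
Qed.

Lemma form_prod_perm g a b : perm_eq a b -> form_prod g a = form_prod g b.
Proof. by move=> ab; apply: perm_big. Qed.

Lemma form_prod_cons g b a : form_prod g (b :: a) = nat_form g b * form_prod g a.
Proof. exact: big_cons. Qed.

Lemma bounded_lower t s a1 a2 b : bounded_by t s (a1 ++ b.+1 :: a2) -> bounded_by t s (a1 ++ b :: a2).
Proof.
rewrite /bounded_by; elim: a1 (bounds t s) => [|x a1 IH] [|y w] //=.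
  by move=> /andP[/ltnW-> ->].
by move=> /andP[-> /IH].
Qed.

(** Modulo the variables after [x_i], multiplying by a linear form the products
attached to [s] stays within the span of those attached to [rcons s i].  It is
enough to multiply by [i + 1] of the forms; the exchange of [b.+1] for [b] lowers
the sum of the entries, on which the induction runs. *)
Lemma multiply_straighten g t (s : seq nat) (i : 'I_n) Z :
    general_position g -> linear_pred Z ->
    sorted leq (rcons s i) -> (i + offset t (size s) < n)%N ->
    (forall a, spaced t a -> bounded_by t (rcons s i) a -> Z (form_prod g a)) ->
  forall a, spaced t a -> bounded_by t s a ->
  forall l : 'I_n -> K,
  exists2 q, Z q & in_tail i ((\sum_(j < n) l j *: 'X_j) * form_prod g a - q).
Proof.
move=> g_good Zlin s_sorted lt_n Zs a.
have [N] := ubnP (sumn a); elim: N a => // N IH a lt_N sp_a bd_a l.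
pose bs := [seq b <- iota 0 (i.+1 + offset t (size a)) | b \notin blocked t a].
have [sz_a _] := bounded_byP bd_a.
pose Z' p := exists2 q, Z q & in_tail i (p * form_prod g a - q).
have Z'lin : linear_pred Z'.
  have tl := linear_in_tail i; split; first by exists 0; [exact: Zlin.1 | rewrite mul0r subrr; exact: tl.1].
  move=> c p p' [q Zq tl_q] [q' Zq' tl_q']; exists (c *: q + q'); first exact: Zlin.2.
  rewrite mulrDl -scalerAl opprD addrACA -scalerBr; exact: tl.2.
have Z'bs b : b \in bs -> Z' (nat_form g b).
  rewrite mem_filter mem_iota /= mem_cat negb_or => /andP[/andP[b_a b_S] lt_b].
  (* Either the product with [b] inserted is admissible, or the same product is
     obtained from the lowered sequence and the form of index [b.+1]. *)
  have [sp | [a1 [a2 [eq_a sp]]]] := spaced_insert sp_a b_a b_S.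
    exists (nat_form g b * form_prod g a); last by rewrite subrr; exact: (linear_in_tail i).1.
    rewrite -form_prod_cons -(form_prod_perm g (perm_insert b a)); apply: Zs => //.
    rewrite /bounded_by bounds_rcons; apply: all2_leq_insert => //; last by rewrite -sz_a; lia.
    by rewrite -bounds_rcons sorted_bounds.
  have [|||q Zq tl_q] := IH (a1 ++ b :: a2) _ _ _ (fun j => if insub b.+1 is Some k then g k j else 0) => //.
  - by move: lt_N; rewrite eq_a !sumn_cat /=; lia.
  - by apply: bounded_lower; rewrite -eq_a.
  exists q => //; move: tl_q.
  have -> : \sum_(j < n) (if insub b.+1 is Some k then g k j else 0) *: 'X_j = nat_form g b.+1.
    rewrite /nat_form; case: insubP => // _; rewrite big1 // => j _; exact: scale0r.
  rewrite -!form_prod_cons eq_a; congr (in_tail i (_ - q)).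
  apply: form_prod_perm; apply/permP => P0 /=; rewrite !count_cat /=; lia.
have [|||q Zq tl_q] := @span_mod_tail g i bs l Z' g_good _ _ _ Z'lin Z'bs.
- by rewrite filter_uniq ?iota_uniq.
- apply/allP => b; rewrite mem_filter mem_iota => /andP[_]; rewrite sz_a /=; lia.
- exact: size_unblocked.
have [q' Zq' tl_q'] := Zq; exists q' => //.
have := in_tailD (in_tailM (q := form_prod g a) tl_q) tl_q'.
by rewrite mulrBl addrA subrK.
Qed.

Lemma mono_of_rcons (s : seq nat) (i : 'I_n) : mono_of n (rcons s i) = (U_(i) + mono_of n s)%MM.
Proof. by apply/mnmP => j; rewrite mnmDE mnm1E !mnmE -cats1 count_cat /= addn0 addnC. Qed.

Lemma mono_of_above (s : seq nat) (i j : 'I_n) : sorted leq (rcons s i) -> (i < j)%N ->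
  mono_of n (rcons s i) j = 0%N.
Proof.
rewrite (sorted_pairwise leq_trans) -cats1 pairwise_cat => /andP[/allrelP le_si _] lt_ij.
rewrite mnmE; apply/count_memPn; apply/negP; rewrite mem_cat mem_seq1 => /orP[j_s|/eqP eq_ji].
  by move: lt_ij; rewrite ltnNge (le_si j i) ?mem_head.
by move: lt_ij; rewrite eq_ji ltnn.
Qed.

(** The form for [rcons s i] is [x_i] times the form for [s], corrected by multiples
of later variables; in the reverse lexicographic order these corrections cannot
affect the initial monomial. *)
Lemma leading_form g t m (s : seq nat) Z :
    general_position g -> linear_pred Z ->
    sorted leq s -> all (gtn m) s -> (m + offset t (size s).-1 <= n)%N ->
    (forall a, spaced t a -> bounded_by t s a -> Z (form_prod g a)) ->
  exists f, [/\ Z f, f@_(mono_of n s) = 1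
    & forall v, v \in msupp f -> v = mono_of n s \/ revlex_lt v (mono_of n s)].
Proof.
move=> g_good; elim/last_ind: s Z => [|s x IH] Z Zlin s_sorted s_m le_n Zs.
  have -> : mono_of n [::] = 0%MM by apply/mnmP => j; rewrite !mnmE.
  exists 1; split; last by move=> v; rewrite msupp1 inE => /eqP; left.
    by have := Zs [::] isT isT; rewrite /form_prod big_nil.
  by rewrite mcoeff1 eqxx.
move: s_m; rewrite all_rcons => /andP[/= lt_x s_m]; rewrite size_rcons /= in le_n.
have lt_xn : (x < n)%N by lia.
pose i := Ordinal lt_xn; rewrite -[x]/(i : nat) in s_sorted Zs *.
have s_s : sorted leq s by move: s_sorted; rewrite -cats1 => /cat_sorted2[].
pose Z' p := exists2 q, Z q & in_tail i ('X_i * p - q).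
have Z'lin : linear_pred Z'.
  have tl := linear_in_tail i; split; first by exists 0; [exact: Zlin.1 | rewrite mulr0 subrr; exact: tl.1].
  move=> c p p' [q Zq tl_q] [q' Zq' tl_q']; exists (c *: q + q'); first exact: Zlin.2.
  rewrite mulrDr -scalerAr opprD addrACA -scalerBr; exact: tl.2.
have [|a sp_a bd_a|f [[q Zq tl_q] f1 f_le]] := IH Z' Z'lin s_s s_m.
- by apply: leq_trans le_n; rewrite leq_add2l offset_mono // leq_pred.
- have [|q Zq tl_q] := multiply_straighten g_good Zlin s_sorted _ Zs sp_a bd_a (fun j => (j == i)%:R).
    by apply: leq_trans le_n; rewrite ltn_add2r.
  exists q => //; move: tl_q; rewrite (bigD1 i) //= eqxx scale1r big1 ?addr0 // => j /negbTE->.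
  exact: scale0r.
rewrite mono_of_rcons; exists q; split=> //.
  have -> : q = 'X_i * f - ('X_i * f - q) by rewrite subKr.
  rewrite mcoeffB mulrC mcoeffMX f1 memN_msupp_eq0 ?subr0 //.
  rewrite mulrC; apply/negP => /tl_q[j lt_ij].
  by rewrite -mono_of_rcons mono_of_above.
move=> v; have -> : q = 'X_i * f - ('X_i * f - q) by rewrite subKr.
move=> /msuppB_le; rewrite mem_cat => /orP[|/tl_q[j lt_ij v_j]].
  rewrite mulrC => /msuppM_le/allpairsP[[y z] /= [/f_le y_le /mem_msuppXP <- ->]].
  by case: y_le => [->|y_lt]; [left; rewrite addmC | right; rewrite addmC revlex_lt_add].
right; apply: revlex_lt_tail lt_ij v_j _ => k lt_ik.
by rewrite -mono_of_rcons mono_of_above.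
Qed.

End GenericForms.

(** * Normal forms *)
Section NormalForm.
Variables (K : fieldType) (n : nat).
Local Notation P := {mpoly K[n]}.
Variables (I : P -> Prop) (S : pred 'X_{1..n}).
Hypothesis I_linear : linear_pred I.
Hypothesis I_initial : forall v, ~~ S v -> exists2 f, I f & initial_monomial f v.

Lemma initial_tail_below (f : P) v : initial_monomial f v ->
  forall y, y \in msupp (f - f@_v *: 'X_[v]) -> degrevlex_lt y v.
Proof.
move=> [_ f_v] y y_h; have neq_yv : y != v.
  apply/eqP => eq_yv; move: y_h; rewrite eq_yv mcoeff_msupp mcoeffB mcoeffZ mcoeffX eqxx.
  by rewrite mulr1 subrr eqxx.
apply: f_v => //; move: y_h => /msuppB_le; rewrite mem_cat => /orP[//|/msuppZ_le/mem_msuppXP eq_vy].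
by rewrite eq_vy eqxx in neq_yv.
Qed.

Lemma linear_predB p q : I p -> I q -> I (p - q).
Proof.
by move=> Ip Iq; rewrite addrC -scaleN1r; apply: I_linear.2.
Qed.

(** The side condition [Q] carries a bound on the monomials of the normal form
through the linear combination. *)
Lemma normal_form_below (Q : 'X_{1..n} -> Prop) (p : P) :
  (forall v, v \in msupp p ->
     exists r, I ('X_[v] - r) /\ forall y, y \in msupp r -> S y /\ Q y) ->
  exists r, I (p - r) /\ forall y, y \in msupp r -> S y /\ Q y.
Proof.
rewrite [in X in _ -> X](mpolyE p); elim: (msupp p) => [|v s IH] nf_s.
  by exists 0; rewrite big_nil subrr; split; [exact: I_linear.1 | move=> y; rewrite msupp0].
have [r [Ir supp_r]] := nf_s v (mem_head _ _).
have [|r' [Ir' supp_r']] := IH; first by move=> y y_s; apply: nf_s; rewrite in_cons y_s orbT.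
exists (p@_v *: r + r'); split.
  rewrite big_cons opprD addrACA -scalerBr; exact: I_linear.2.
by move=> y /msuppD_le; rewrite mem_cat => /orP[/msuppZ_le/supp_r|/supp_r'].
Qed.

Lemma normal_form_mono v :
  exists r, I ('X_[v] - r) /\
    forall y, y \in msupp r -> S y /\ (y = v \/ degrevlex_lt y v).
Proof.
elim/degrevlex_ind: v => v IH; have [Sv|nSv] := boolP (S v).
  exists 'X_[v]; rewrite subrr; split; first exact: I_linear.1.
  by move=> y /mem_msuppXP <-; split=> //; left.
have [f If f_v] := I_initial nSv; have h_lt := initial_tail_below f_v.
set h := f - _ in h_lt; have f_v_neq0 : f@_v != 0 by rewrite -mcoeff_msupp; case: f_v.
have [y y_h|r [Ir supp_r]] := @normal_form_below (fun y => degrevlex_lt y v) h.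
  have [r [Ir supp_r]] := IH y (h_lt y y_h); exists r; split=> // z /supp_r[Sz z_y]; split=> //.
  by case: z_y => [->|lt_zy]; [exact: h_lt | exact: degrevlex_trans lt_zy (h_lt y y_h)].
exists (- (f@_v)^-1 *: r); split; last by move=> y /msuppZ_le/supp_r[Sy lt_y]; split=> //; right.
rewrite (_ : _ - _ = (f@_v)^-1 *: (f - (h - r)) + 0).
  by apply: I_linear.2; [exact: linear_predB | exact: I_linear.1].
rewrite addr0 (_ : f - _ = f@_v *: 'X_[v] + r); last by rewrite /h; ring.
by rewrite scalerDr scalerA mulVf // scale1r scaleNr opprK.
Qed.

Lemma normal_form p :
  exists r, I (p - r) /\ forall y, y \in msupp r -> S y.
Proof.
have [v _|r [Ir supp_r]] := @normal_form_below (fun=> True) p.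
  by have [r [Ir supp_r]] := normal_form_mono v; exists r; split=> // y /supp_r[].
by exists r; split=> // y /supp_r[].
Qed.

(** Reducing everything but the initial term turns an element of [I] with a
standard initial monomial into a nonzero element supported on standard
monomials. *)
Lemma initial_standard :
    (forall r, I r -> (forall y, y \in msupp r -> S y) -> r = 0) ->
  forall p v, I p -> initial_monomial p v -> ~~ S v.
Proof.
move=> I_free p v Ip p_v; apply/negP => Sv; have h_lt := initial_tail_below p_v.
set h := p - _ in h_lt; have p_v_neq0 : p@_v != 0 by rewrite -mcoeff_msupp; case: p_v.
have [y y_h|r [Ir supp_r]] := @normal_form_below (fun y => degrevlex_lt y v) h.
  have [r [Ir supp_r]] := normal_form_mono y; exists r; split=> // z /supp_r[Sz z_y]; split=> //.
  by case: z_y => [->|lt_zy]; [exact: h_lt | exact: degrevlex_trans lt_zy (h_lt y y_h)].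
have : p@_v *: 'X_[v] + r = 0.
  apply: I_free => [|y].
    by rewrite (_ : _ + r = p - (h - r)); [exact: linear_predB | rewrite /h; ring].
  by move=> /msuppD_le; rewrite mem_cat => /orP[/msuppZ_le/mem_msuppXP <- //|/supp_r[]//].
move=> /(congr1 (mcoeff v)); rewrite mcoeffD mcoeffZ mcoeffX eqxx mulr1 mcoeff0.
rewrite (@memN_msupp_eq0 _ _ r) ?addr0; first by apply/eqP.
by apply/negP => /supp_r[_]; rewrite degrevlex_irr.
Qed.

End NormalForm.

(** * Ideals and linear changes of variables *)
Section Ideals.

Lemma ideal_genD (R : comNzRingType) (G : R -> Prop) p q :
  ideal_gen G p -> ideal_gen G q -> ideal_gen G (p + q).
Proof.
move=> [s [Gs ->]] [s' [Gs' ->]]; exists (s ++ s'); rewrite big_cat; split=> // cg.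
by rewrite mem_cat => /orP[/Gs|/Gs'].
Qed.

Lemma ideal_genM (R : comNzRingType) (G : R -> Prop) c p :
  ideal_gen G p -> ideal_gen G (c * p).
Proof.
move=> [s [Gs ->]]; exists [seq (c * cg.1, cg.2) | cg <- s]; split.
  by move=> _ /mapP[cg /Gs Gcg ->].
by rewrite big_map mulr_sumr; apply: eq_bigr => cg _; rewrite mulrA.
Qed.

Lemma ideal_gen0 (R : comNzRingType) (G : R -> Prop) : ideal_gen G 0.
Proof. by exists [::]; rewrite big_nil. Qed.

Lemma ideal_gen_mem (R : comNzRingType) (G : R -> Prop) q : G q -> ideal_gen G q.
Proof. by move=> Gq; exists [:: (1, q)]; rewrite big_seq1 mul1r; split=> // _ /[1!inE] /eqP->. Qed.

Lemma ideal_gen_min (R : comNzRingType) (G Z : R -> Prop) :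
    Z 0 -> (forall p q, Z p -> Z q -> Z (p + q)) -> (forall c p, Z p -> Z (c * p)) ->
    (forall q, G q -> Z q) ->
  forall p, ideal_gen G p -> Z p.
Proof.
move=> Z0 ZD ZM GZ p [s [Gs ->]]; elim: s Gs => [|cg s IH] Gs; first by rewrite big_nil.
rewrite big_cons; apply: ZD; first by apply/ZM/GZ/Gs/mem_head.
by apply: IH => x x_s; apply: Gs; rewrite in_cons x_s orbT.
Qed.

End Ideals.

Section LinearChange.
Variables (K : fieldType) (n : nat).
Local Notation P := {mpoly K[n]}.

Lemma comp_mpolyA (p : P) (a b : n.-tuple P) :
  (p \mPo a) \mPo b = p \mPo [tuple (tnth a i) \mPo b | i < n].
Proof.
rewrite [p \mPo a]comp_mpolyE linear_sum /= [RHS]comp_mpolyE; apply: eq_bigr => v _.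
rewrite linearZ /= rmorph_prod; congr (_ *: _); apply: eq_bigr => i _.
by rewrite rmorphXn tnth_mktuple.
Qed.

Lemma linear_formE (l : 'I_n -> K) (T : n.-tuple P) :
  (\sum_(j < n) l j *: 'X_j) \mPo T = \sum_(j < n) l j *: tnth T j.
Proof.
rewrite linear_sum; apply: eq_bigr => j _.
by rewrite linearZ /= comp_mpolyXU -tnth_nth.
Qed.

Variable g : 'M[K]_n.
Hypothesis g_unit : g \in unitmx.

Lemma linear_changeK q : linear_change g (linear_change (invmx g) q) = q.
Proof.
rewrite /linear_change comp_mpolyA -[RHS]comp_mpoly_id; congr (q \mPo _).
apply: eq_from_tnth => i; rewrite !tnth_mktuple linear_formE.
rewrite (eq_bigr (fun j => \sum_(k < n) (invmx g i j * g j k) *: 'X_k)); last first.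
  by move=> j _; rewrite tnth_mktuple scaler_sumr; apply: eq_bigr => k _; rewrite scalerA.
rewrite exchange_big /= (eq_bigr (fun k => (i == k)%:R *: 'X_k)) => [|k _]; last first.
  rewrite -scaler_suml; have := congr1 (fun A : 'M_n => A i k) (mulVmx g_unit).
  by rewrite !mxE => ->.
rewrite (bigD1 i) //= eqxx scale1r big1 ?addr0 // => k neq_ki.
by rewrite eq_sym (negbTE neq_ki) scale0r.
Qed.

Lemma linear_change_prod (A : {set 'I_n}) :
  linear_change g (\prod_(i in A) 'X_i) = \prod_(i in A) row_form g i.
Proof.
rewrite /linear_change rmorph_prod; apply: eq_bigr => i _.
by rewrite /= comp_mpolyXU -tnth_nth tnth_mktuple.
Qed.

Variable G : P -> Prop.
Local Notation gI := (ideal_change g (ideal_gen G)).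

Lemma ideal_changeD p q : gI p -> gI q -> gI (p + q).
Proof.
move=> [x Ix ->] [y Iy ->]; exists (x + y); first exact: ideal_genD.
by rewrite /linear_change rmorphD.
Qed.

(** The image of an ideal is an ideal because the change of variables is
surjective. *)
Lemma ideal_changeM c p : gI p -> gI (c * p).
Proof.
move=> [x Ix ->]; exists (linear_change (invmx g) c * x); first exact: ideal_genM.
by rewrite -{1}(linear_changeK c) /linear_change rmorphM.
Qed.

Lemma ideal_change_linear : linear_pred gI.
Proof.
split; first by exists 0; [exact: ideal_gen0 | rewrite /linear_change rmorph0].
by move=> c p q Ip Iq; apply: ideal_changeD => //; rewrite -mul_mpolyC; apply: ideal_changeM.
Qed.

End LinearChange.

(** * Linear independence of the standard monomials *)
Section CoordinateSubspace.
Variables (K : fieldType) (n : nat).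
Local Notation P := {mpoly K[n]}.

Lemma linear_form_eq0 (l : 'rV[K]_n) : \sum_(j < n) l 0 j *: 'X_j = 0 :> P -> l = 0.
Proof.
move=> l0; apply/rowP => j; rewrite mxE.
have := congr1 (mcoeff U_(j)) l0; rewrite mcoeff0 raddf_sum /= => <-.
rewrite (bigD1 j) //= mcoeffZ mcoeffXU eqxx mulr1 big1 ?addr0 // => i neq_ij.
by rewrite mcoeffZ mcoeffXU (negbTE neq_ij) mulr0.
Qed.

(** On the linear space where the forms outside [F] vanish, the variables from
[x_#|~: F|] on are coordinates, and each form in [F] is nonzero since the rows of
[g] are independent.  The tuple [T] is the resulting parametrization. *)
Lemma coordinate_subspace (g : 'M[K]_n) (F : {set 'I_n}) :
    g \in unitmx -> general_position g ->
  exists T : n.-tuple P,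
    [/\ forall j : 'I_n, (#|~: F| <= j)%N -> tnth T j = 'X_j,
        forall i, i \notin F -> row_form g i \mPo T = 0
      & forall i, i \in F -> row_form g i \mPo T != 0].
Proof.
move=> g_unit g_good.
have lt_k : (#|~: F| < n.+1)%N by rewrite ltnS -[leqRHS]card_ord max_card.
pose k : 'I_n.+1 := Ordinal lt_k.
pose f (r : 'I_k) : 'I_n := enum_val (r : 'I_#|~: F|).
have f_F r : f r \notin F by rewrite -in_setC enum_valP.
have f_onto i : i \notin F -> exists r, f r = i.
  by rewrite -in_setC => i_F; exists (enum_rank_in i_F i); rewrite /f enum_rankK_in.
pose w := @widen_ord k n (ltn_ord k).
pose E : 'M[K]_(n, k) := \matrix_(j, c) (w c == j)%:R.
pose S : 'M[K]_(k, n) := \matrix_(r, j) (f r == j)%:R.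
have SgE : S *m g *m E = \matrix_(r < k, c < k) g (f r) (w c).
  apply/matrixP => r c; rewrite !mxE (bigD1 (w c)) //= !mxE eqxx mulr1.
  rewrite (bigD1 (f r)) //= !mxE eqxx mul1r big1 ?addr0 => [|i neq_i]; last first.
    by rewrite !mxE eq_sym (negbTE neq_i) mul0r.
  rewrite big1 ?addr0 // => j neq_j; rewrite !mxE [_ == j]eq_sym (negbTE neq_j) mulr0 //.
have M_unit : S *m g *m E \in unitmx.
  by rewrite unitmxE unitfE SgE; apply: g_good; apply: enum_val_inj.
(* [S] selects the rows outside [F], [E] the first columns; [W] is the projection
   onto the kernel of [S *m g] along the first coordinates. *)
pose H := invmx (S *m g *m E) *m (S *m g).
pose W : 'M[K]_n := 1%:M - E *m H.
pose T := [tuple \sum_(x < n) W j x *: ('X_x : P) | j < n].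
have row_T i : row_form g i \mPo T = \sum_(x < n) (g *m W) i x *: 'X_x.
  rewrite linear_formE (eq_bigr (fun j => \sum_(x < n) (g i j * W j x) *: 'X_x)); last first.
    by move=> j _; rewrite tnth_mktuple scaler_sumr; apply: eq_bigr => x _; rewrite scalerA.
  by rewrite exchange_big; apply: eq_bigr => x _; rewrite !mxE scaler_suml.
have SgW : S *m (g *m W) = 0.
  by rewrite /W /H mulmxBr mulmx1 mulmxBr !mulmxA mulmxV // mul1mx subrr.
have wE (j : 'I_n) c : (#|~: F| <= j)%N -> (w c == j) = false.
  by move=> le_kj; apply/eqP => /(congr1 val) /= eq_cj; move: (ltn_ord c); rewrite eq_cj ltnNge le_kj.
exists T; split=> [j le_kj | i /f_onto[r <-] | i i_F].
- rewrite tnth_mktuple (bigD1 j) //= big1 ?addr0 => [|x neq_xj].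
    by rewrite !mxE eqxx big1 ?subr0 ?scale1r // => c _; rewrite !mxE wE ?mul0r.
  rewrite !mxE eq_sym (negbTE neq_xj) big1 ?subrr ?scale0r // => c _.
  by rewrite !mxE wE ?mul0r.
- rewrite row_T big1 // => x _; move: (g *m W) SgW => B SB.
  have := congr1 (fun A : 'M_(_, _) => A r x) SB.
  rewrite !mxE (bigD1 (f r)) //= !mxE eqxx mul1r big1 ?addr0 => [->|j neq_j]; first exact: scale0r.
  by rewrite !mxE eq_sym (negbTE neq_j) mul0r.
apply/eqP; rewrite row_T => row0.
have {row0} : row i (g *m W) = 0.
  by apply: linear_form_eq0; rewrite -[RHS]row0; apply: eq_bigr => x _; rewrite [row _ _ _ _]mxE.
rewrite row_mul /W mulmxBr mulmx1 => /(congr1 (mulmx^~ (invmx g))).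
rewrite mul0mx mulmxBl /H !mulmxA.
rewrite -[X in _ - X]mulmxA mulmxV // mulmx1 -row_mul mulmxV // => /matrixP/(_ 0 i).
rewrite !mxE eqxx big1 ?subr0 => [|r _]; first by move/eqP; rewrite oner_eq0.
rewrite [S r i]mxE (_ : _ == i = false) ?mulr0 //.
by apply/eqP => eq_fi; move: (f_F r); rewrite eq_fi i_F.
Qed.

End CoordinateSubspace.

Section Restriction.
Variables (K : fieldType) (m n : nat) (hmn : (m <= n)%N).
Local Notation P := {mpoly K[n]}.

Definition low (v : 'X_{1..n}) : 'X_{1..m} := [multinom v (widen_ord hmn i) | i < m].

Definition high (v : 'X_{1..n}) : 'X_{1..n} :=
  [multinom if (i < m)%N then 0%N else v i | i < n].

Definition emb (u : 'X_{1..m}) : 'X_{1..n} := mono_of n (word u).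

Lemma embE u (i : 'I_m) : emb u (widen_ord hmn i) = u i.
Proof. by rewrite -[in RHS](mono_of_word u) !mnmE. Qed.

Lemma emb_ge u (i : 'I_n) : (m <= i)%N -> emb u i = 0%N.
Proof.
move=> le_mi; rewrite mnmE; apply/count_memPn; apply/negP => /mem_word.
by rewrite ltnNge le_mi.
Qed.

Lemma low_emb u : low (emb u) = u.
Proof. by apply/mnmP => i; rewrite mnmE embE. Qed.

Lemma lowD u v : low (u + v)%MM = (low u + low v)%MM.
Proof. by apply/mnmP => i; rewrite !(mnmE, mnmDE). Qed.

Lemma emb_high v : (emb (low v) + high v)%MM = v.
Proof.
apply/mnmP => i; rewrite mnmDE [high v i]mnmE; case: ltnP => [lt_im | /emb_ge-> //].
have -> : i = widen_ord hmn (Ordinal lt_im) by apply: val_inj.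
by rewrite embE mnmE addn0.
Qed.

Variables (g : 'M[K]_n) (D : {set {set 'I_n}}) (Us : seq 'X_{1..m}).
Variable facet_of : 'X_{1..m} -> {set 'I_n}.
Hypotheses (g_unit : g \in unitmx) (g_good : general_position g) (Us_uniq : uniq Us).
Hypothesis facet_card : forall u, u \in Us -> #|~: facet_of u| = m.
Hypothesis facet_sub : forall u v, u \in Us -> v \in Us -> facet_of u \subset facet_of v -> u = v.
Hypothesis facet_face : forall A u, A \notin D -> u \in Us -> ~~ (A \subset facet_of u).
Local Notation I := (ideal_change g (@stanley_reisner K n D)).
Hypothesis normal : forall p, exists r, I (p - r) /\ forall y, y \in msupp r -> low y \in Us.

(** The coefficient of the monomial [u] when a polynomial is expanded over the
ring of polynomials in the last variables. *)
Definition low_coeff (r : P) u : P := \sum_(v <- msupp r | low v == u) r@_v *: 'X_[high v].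

Lemma low_decomp r : (forall y, y \in msupp r -> low y \in Us) ->
  r = \sum_(u <- Us) 'X_[emb u] * low_coeff r u.
Proof.
move=> supp_r; rewrite [LHS]mpolyE /low_coeff.
transitivity (\sum_(u <- Us) \sum_(v <- msupp r | low v == u) r@_v *: 'X_[v]); last first.
  apply: eq_bigr => u _; rewrite mulr_sumr; apply: eq_bigr => v /eqP <-.
  by rewrite -scalerAr -mpolyXD emb_high.
rewrite (exchange_big_dep xpredT) //=; apply: eq_big_seq => v v_r.
rewrite big_mkcond (bigD1_seq (low v)) ?supp_r //= eqxx big1 ?addr0 // => u neq_u.
by rewrite eq_sym (negbTE neq_u).
Qed.

Let N := size Us.
Let u_ (k : 'I_N) := tnth (in_tuple Us) k.

Let u_in k : u_ k \in Us. Proof. exact: mem_tnth. Qed.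

Let u_inj : injective u_.
Proof. by apply/tuple_uniqP. Qed.

(** Applying the parametrizations of all facets to a relation among standard
monomials gives a linear system whose square matrix [M] is nonsingular: the
products of the forms of each facet separate the facets, and their normal forms
give [C] with [C *m M] diagonal. *)
Lemma standard_free r : I r -> (forall y, y \in msupp r -> low y \in Us) -> r = 0.
Proof.
have [T T_P] := @fin_all_exists _ _ _ (fun k : 'I_N => coordinate_subspace (facet_of (u_ k)) g_unit g_good).
pose phi k p := p \mPo T k.
have phi_low k q u : phi k (low_coeff q u) = low_coeff q u.
  rewrite /phi raddf_sum; apply: eq_bigr => v _; rewrite /= linearZ /= comp_mpolyX [in RHS]mpolyXE_id.
  congr (_ *: _); apply: eq_bigr => j _; rewrite mnmE; case: ltnP => // le_mj.
  by have [-> //] := T_P k; rewrite facet_card.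
have phi_I k q : I q -> phi k q = 0.
  move=> [p Ip ->]; move: p Ip; apply: ideal_gen_min => [|p q' p0 q0|c p p0|_ [A A_D ->]].
  - by rewrite /phi /linear_change !rmorph0.
  - by rewrite /phi /linear_change !rmorphD /=; rewrite /phi /linear_change in p0 q0; rewrite p0 q0 addr0.
  - by rewrite /phi /linear_change !rmorphM /=; rewrite /phi /linear_change in p0; rewrite p0 mulr0.
  have [i i_A i_F] := subsetPn (facet_face A_D (u_in k)).
  rewrite linear_change_prod /phi rmorph_prod (bigD1 i) //=.
  by have [_ -> // _] := T_P k; rewrite mul0r.
have phi_decomp k q : (forall y, y \in msupp q -> low y \in Us) ->
    phi k q = \sum_(j < N) low_coeff q (u_ j) * phi k 'X_[emb (u_ j)].
  move=> supp_q; rewrite {1}(low_decomp supp_q) big_tnth /phi rmorph_sum; apply: eq_bigr => j _.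
  by rewrite rmorphM /= mulrC [X in X * _]phi_low.
pose G k : P := \prod_(i in facet_of (u_ k)) row_form g i.
have [nf nf_P] := @fin_all_exists _ _ _ (fun k : 'I_N => normal (G k)).
pose C : 'M[P]_N := \matrix_(k, j) low_coeff (nf k) (u_ j).
pose M : 'M[P]_N := \matrix_(j, l) phi l 'X_[emb (u_ j)].
have CM : C *m M = diag_mx (\row_k phi k (G k)).
  apply/matrixP => k l; rewrite !mxE.
  transitivity (phi l (nf k)).
    by rewrite (phi_decomp _ _ (nf_P k).2); apply: eq_bigr => j _; rewrite !mxE.
  have -> : phi l (nf k) = phi l (G k).
    by apply/eqP; rewrite eq_sym -subr_eq0 -raddfB; apply/eqP/phi_I; case: (nf_P k).
  case: eqVneq => [-> | neq_kl]; first by rewrite mulr1n.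
  rewrite mulr0n; have /subsetPn[i i_k i_l] : ~~ (facet_of (u_ k) \subset facet_of (u_ l)).
    by apply: contra neq_kl => /(facet_sub (u_in k) (u_in l))/u_inj->.
  rewrite /G /phi rmorph_prod (bigD1 i) //=.
  by have [_ -> // _] := T_P l; rewrite mul0r.
have M_det : \det M != 0.
  have : \det (C *m M) != 0.
    rewrite CM det_diag; apply/prodf_neq0 => k _; rewrite mxE /G /phi rmorph_prod.
    by apply/prodf_neq0 => i i_F; have [_ _] := T_P k; apply.
  by rewrite det_mulmx mulf_eq0 negb_or => /andP[].
move=> Ir supp_r; pose c : 'rV[P]_N := \row_j low_coeff r (u_ j).
have cM : c *m M = 0.
  apply/rowP => l; rewrite !mxE -[RHS](phi_I l r Ir) phi_decomp //.
  by apply: eq_bigr => j _; rewrite !mxE.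
have c0 j : low_coeff r (u_ j) = 0.
  have := congr1 (mulmx^~ (\adj M)) cM; rewrite mul0mx -mulmxA mul_mx_adj mul_mx_scalar.
  by move=> /rowP/(_ j); rewrite !mxE => /eqP; rewrite mulf_eq0 (negbTE M_det) => /eqP.
rewrite (low_decomp supp_r) big_tnth big1 // => j _.
by rewrite [X in _ * X]c0 mulr0.
Qed.

End Restriction.

(** * General position is a nonempty open condition *)
Section Genericity.
Variables (K : fieldType) (n : nat).

Definition minors_poly : {mpoly K[n * n]} :=
  \prod_(k < n.+1) \prod_(f : {ffun 'I_k -> 'I_n} | injectiveb f)
    initial_minor (\matrix_(i < n, j < n) 'X_(mxvec_index i j)) f.

Lemma minors_polyE (g : 'M[K]_n) : minors_poly.@[mxvec g 0] =
  \prod_(k < n.+1) \prod_(f : {ffun 'I_k -> 'I_n} | injectiveb f) initial_minor g f.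
Proof.
rewrite rmorph_prod; apply: eq_bigr => k _; rewrite rmorph_prod; apply: eq_bigr => f _.
rewrite /initial_minor -det_map_mx; congr (\det _); apply/matrixP => r c.
by rewrite [in RHS]mxE 3!mxE /= mevalXU mxvecE.
Qed.

Lemma general_positionP (g : 'M[K]_n) : general_position g <-> minors_poly.@[mxvec g 0] != 0.
Proof.
rewrite minors_polyE; split=> [g_good | /prodf_neq0 g_good k f f_inj].
  apply/prodf_neq0 => k _; apply/prodf_neq0 => f /injectiveP; exact: g_good.
have /prodf_neq0/(_ (finfun f)) := g_good k isT; rewrite /initial_minor.
have -> : injectiveb (finfun f) by apply/injectiveP => r s; rewrite !ffunE; apply: f_inj.
by move=> /(_ isT); congr (\det _ != 0); apply/matrixP => r c; rewrite !mxE ffunE.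
Qed.

Lemma general_position_open : zariski_open_GL (fun g : 'M[K]_n => g \in unitmx /\ general_position g).
Proof.
exists (eq minors_poly) => g; split=> [[g_unit /general_positionP]|[g_unit [_ <- /general_positionP]]] //.
by move=> g_good; split=> //; exists minors_poly.
Qed.

Lemma general_position_exists : infinite_type K -> exists g : 'M[K]_n, g \in unitmx /\ general_position g.
Proof.
move=> K_inf.
(* For [g i j = a_i ^ j] the minors in question are Vandermonde determinants. *)
have [a [a_size a_uniq]] : exists a : seq K, size a = n /\ uniq a.
  elim: n => [|k [a [a_size a_uniq]]]; first by exists [::].
  by have [x x_a] := K_inf a; exists (x :: a); rewrite /= a_size x_a.
pose g : 'M[K]_n := \matrix_(i, j) nth 0 a i ^+ j.
have g_good : general_position g.
  move=> k f f_inj; rewrite /initial_minor.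
  rewrite (_ : \matrix_(r, c) _ = (Vandermonde k (\row_r nth 0 a (f r)))^T); last first.
    by apply/matrixP => r c; rewrite !mxE.
  rewrite det_tr det_Vandermonde; apply/prodf_neq0 => r _; apply/prodf_neq0 => c lt_rc.
  rewrite !mxE subr_eq0 nth_uniq ?a_size //; apply: contraTneq lt_rc => /val_inj/f_inj->.
  by rewrite ltnn.
exists g; split=> //; rewrite unitmxE unitfE.
have := g_good ord_max id (fun _ _ => id); congr (\det _ != 0).
by apply/matrixP => i j; rewrite !mxE.
Qed.

End Genericity.

(** * The monomial ideal and extension of scalars *)
Section MonomialIdeal.
Variables (K : fieldType) (m t : nat) (U : {fset 'X_{1..m}}).
Hypothesis U_order : order_ideal U.
Local Notation d := (dmax U).
Local Notation n := (m + t + d)%N.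
Local Notation P := {mpoly K[n]}.

Lemma le_m_n : (m <= n)%N. Proof. by rewrite -addnA leq_addr. Qed.

Local Notation low := (low le_m_n).

Lemma poly_inclX (u : 'X_{1..m}) : poly_incl t d ('X_[u] : {mpoly K[m]}) = 'X_[emb n u].
Proof.
rewrite /poly_incl comp_mpolyX [RHS]mpolyXE_id.
rewrite (bigID (fun i : 'I_n => (i < m)%N)) /= [X in _ = _ * X]big1 ?mulr1; last first.
  by move=> i; rewrite -leqNgt => /emb_ge->.
rewrite (big_ord_narrow le_m_n); apply: eq_bigr => i _; rewrite tnth_mktuple embE.
by congr ('X_ _ ^+ _); apply: val_inj.
Qed.

Lemma low_closed u v : low u \notin U -> low (u + v)%MM \notin U.
Proof.
apply: contra; rewrite lowD; case: U_order => U_dvd _ _ /U_dvd; apply.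
exact: lem_addr.
Qed.

Lemma extended_complP (p : P) :
  ideal_ext (@poly_incl K m t d) (order_ideal_compl K U) p <->
  forall v, v \in msupp p -> low v \notin U.
Proof.
pose Z (q : P) := forall v, v \in msupp q -> low v \notin U.
have ZD q q' : Z q -> Z q' -> Z (q + q').
  by move=> Zq Zq' v /msuppD_le; rewrite mem_cat => /orP[/Zq|/Zq'].
have ZM q q' : Z q' -> Z (q * q').
  by move=> Zq' v /msuppM_le/allpairsP[[x y] /= [_ /Zq' y_low ->]]; rewrite addmC low_closed.
have Z0 : Z 0 by move=> v; rewrite msupp0.
split.
  apply: (ideal_gen_min (Z := Z)) => // _ [q Jq ->].
  move: q Jq; apply: (ideal_gen_min (Z := fun q => Z (poly_incl t d q))) => [|q q'|q q'|_ [u u_U ->]].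
  - by rewrite /poly_incl rmorph0.
  - by rewrite /poly_incl rmorphD; apply: ZD.
  - by rewrite /poly_incl rmorphM; apply: ZM.
  by rewrite poly_inclX => v /mem_msuppXP <-; rewrite low_emb.
rewrite [X in ideal_ext _ _ X]mpolyE; elim: (msupp p) => [|v s IH] s_low.
  by rewrite big_nil; apply: ideal_gen0.
rewrite big_cons; apply: ideal_genD; last by apply: IH => y y_s; rewrite s_low // in_cons y_s orbT.
rewrite -mul_mpolyC -(emb_high le_m_n v) addmC mpolyXD mulrA; apply: ideal_genM.
apply: ideal_gen_mem; exists 'X_[low v]; last by rewrite poly_inclX.
by apply: ideal_gen_mem; exists (low v); rewrite ?s_low ?mem_head.
Qed.

End MonomialIdeal.

Section ScalarExtension.
Variables (K L : fieldType) (iota : {rmorphism K -> L}).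

Lemma scalar_ext_stanley_reisner n (D : {set {set 'I_n}}) p :
  scalar_ext iota (stanley_reisner K D) p <-> stanley_reisner L D p.
Proof.
have map_face (F : {set 'I_n}) : map_mpoly iota (\prod_(i in F) 'X_i) = \prod_(i in F) 'X_i.
  by rewrite rmorph_prod; apply: eq_bigr => i _; rewrite /= map_mpolyX.
split; apply: ideal_gen_min; try exact: ideal_gen0; try exact: ideal_genD; try exact: ideal_genM.
  move=> _ [q Iq ->]; move: q Iq; apply: ideal_gen_min => [|q q' Iq Iq'|q q' Iq'|_ [F F_D ->]].
  - by rewrite rmorph0; apply: ideal_gen0.
  - by rewrite rmorphD; apply: ideal_genD.
  - by rewrite rmorphM; apply: ideal_genM.
  by apply: ideal_gen_mem; exists F; rewrite ?map_face.
move=> _ [F F_D ->]; apply: ideal_gen_mem; exists (\prod_(i in F) 'X_i); last by rewrite map_face.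
by apply: ideal_gen_mem; exists F.
Qed.

Lemma scalar_ext_extended_compl m t (U : {fset 'X_{1..m}}) (hU : order_ideal U) p :
  scalar_ext iota (ideal_ext (@poly_incl K m t (dmax U)) (order_ideal_compl K U)) p <->
  ideal_ext (@poly_incl L m t (dmax U)) (order_ideal_compl L U) p.
Proof.
split.
  apply: ideal_gen_min; try exact: ideal_gen0; try exact: ideal_genD; try exact: ideal_genM.
  move=> _ [q /(extended_complP hU) q_low ->]; apply/(extended_complP hU) => v v_q.
  apply: q_low; move: v_q; rewrite !mcoeff_msupp mcoeff_map_mpoly; apply: contra => /eqP->.
  exact/eqP/rmorph0.
move=> /(extended_complP hU).
rewrite [X in scalar_ext _ _ X]mpolyE; elim: (msupp p) => [|v s IH] s_low.
  by rewrite big_nil; apply: ideal_gen0.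
rewrite big_cons; apply: ideal_genD; last by apply: IH => y y_s; rewrite s_low // in_cons y_s orbT.
rewrite -mul_mpolyC; apply: ideal_genM; apply: ideal_gen_mem.
exists 'X_[v]; last by rewrite map_mpolyX.
by apply/(extended_complP hU) => y /mem_msuppXP <-; rewrite s_low ?mem_head.
Qed.

End ScalarExtension.

Lemma generic_initial_ext (K : fieldType) n (I I' J J' : {mpoly K[n]} -> Prop) :
    (forall p, I p <-> I' p) -> (forall p, J p <-> J' p) ->
  generic_initial I' J' -> generic_initial I J.
Proof.
move=> eqI eqJ [O [O_open O_ne O_gin]]; exists O; split=> // g Og p.
rewrite eqJ -(O_gin g Og).
by split; apply: ideal_gen_min; try exact: ideal_gen0; try exact: ideal_genD; try exact: ideal_genM;
  move=> _ [q [v [[x /eqI Ix ->] v_q ->]]]; apply: ideal_gen_mem;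
  exists (linear_change g x), v; split=> //; exists x.
Qed.

(** * The generic initial ideal of a squeezed complex *)
Section Squeezed.
Variables (K : fieldType) (m t : nat) (U : {fset 'X_{1..m}}).
Hypotheses (U_order : order_ideal U) (U_shifted : shifted U).
Local Notation d := (dmax U).
Local Notation n := (m + t + d)%N.
Local Notation P := {mpoly K[n]}.
Local Notation low := (low (le_m_n t U)).
Variable g : 'M[K]_n.
Hypotheses (g_unit : g \in unitmx) (g_good : general_position g).
Local Notation I := (ideal_change g (stanley_reisner K (squeezed t U))).

Lemma mdeg_dmax (u : 'X_{1..m}) : u \in U -> (mdeg u <= d)%N.
Proof. by move=> u_U; apply: leq_bigmax_seq. Qed.

Lemma row_form_homog i : row_form g i \is 1.-homog.
Proof.
by apply: rpred_sum => j _; apply: dhomogZ; rewrite dhomogX /= mdeg1.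
Qed.

Lemma form_prod_homog a : form_prod g a \is (size a).-homog.
Proof.
elim: a => [|b a IH]; first by rewrite /form_prod big_nil dhomog1.
rewrite form_prod_cons -[size _]add1n; apply: dhomogM => //.
by rewrite /nat_form; case: insubP => [i _ _|_]; [exact: row_form_homog | exact: dhomog0].
Qed.

Lemma form_prod_nonface (s a : seq nat) :
    all (gtn m) s -> mono_of m s \notin U -> (size s <= d.+1)%N ->
    spaced t a -> bounded_by t s a ->
  I (form_prod g a).
Proof.
move=> s_m s_U s_size sp_a bd_a; pose F := [set k : 'I_n | (k : nat) \in a].
have a_lt x : x \in a -> (x < n)%N.
  have [sz_a a_le] := bounded_byP bd_a.
  move=> /(nthP 0%N)[l]; rewrite sz_a => lt_l <-.
  have := a_le l lt_l; have := allP s_m _ (mem_nth 0%N lt_l) => /=.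
  by rewrite /offset; lia.
have F_D : F \notin squeezed t U.
  apply: (spaced_nonface U_order U_shifted s_m s_U sp_a bd_a) => x x_a.
  by exists (Ordinal (a_lt x x_a)); rewrite ?inE.
exists (\prod_(i in F) 'X_i); first by apply: ideal_gen_mem; exists F.
rewrite linear_change_prod /form_prod.
have F_a : perm_eq a [seq val i | i <- enum F].
  apply: uniq_perm; first exact: (sorted_uniq ltn_trans ltnn (spaced_sorted sp_a)).
    by rewrite (map_inj_uniq val_inj) enum_uniq.
  move=> x; apply/idP/mapP => [x_a | [i]]; last by rewrite mem_enum inE => i_a ->.
  by exists (Ordinal (a_lt x x_a)); rewrite // mem_enum inE.
rewrite (perm_big _ F_a) big_map big_enum; apply: eq_bigr => i _.
by rewrite /nat_form valK.
Qed.

(** The forms live in [n] variables only for words of length at most [d + 1].  This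
is enough: a longer word is cut to its first [d + 1] letters, which form a
monomial of degree too large for [U]. *)
Lemma initial_nonstandard v : low v \notin U -> exists2 f, I f & initial_monomial f v.
Proof.
move=> v_U; pose s := take d.+1 (word (low v)).
have s_m : all (gtn m) s by apply/allP => x /mem_take/mem_word.
have s_size : (size s <= d.+1)%N by rewrite size_take_min geq_minl.
have s_U : mono_of m s \notin U.
  rewrite /s; case: (leqP (size (word (low v))) d.+1) => [le_d|lt_d].
    by rewrite take_oversize // mono_of_word.
  apply/negP => /mdeg_dmax; rewrite -size_word.
  rewrite (_ : size _ = d.+1) ?ltnn //.
  have : perm_eq (word (mono_of m s)) s.
    apply/allP => x; rewrite mem_cat => x_in; apply/eqP.
    have lt_x : (x < m)%N by case/orP: x_in => [/mem_word//|/(allP s_m)].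
    have := mono_of_word (mono_of m s) => /mnmP/(_ (Ordinal lt_x)); rewrite !mnmE; exact.
  by move=> /perm_size->; rewrite size_takel // ltnW.
have s_sorted : sorted leq s by apply: take_sorted; apply: sorted_word.
pose Z (p : P) := I p /\ p \is (size s).-homog.
have Zlin : linear_pred Z.
  have I_lin := ideal_change_linear g_unit (fun q => exists2 F : {set 'I_n}, F \notin squeezed t U & q = \prod_(i in F) 'X_i).
  split; first by split; [exact: I_lin.1 | exact: dhomog0].
  move=> c p q [Ip hp] [Iq hq]; split; first exact: I_lin.2.
  by apply: dhomogD => //; apply: dhomogZ.
have [||f [[If f_homog] f1 f_lt]] := leading_form g_good Zlin s_sorted s_m (t := t).
- by move: s_size; rewrite /offset; lia.
- move=> a sp_a bd_a; split; first exact: form_prod_nonface sp_a bd_a.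
  by have [<- _] := bounded_byP bd_a; apply: form_prod_homog.
have s_v : (mono_of n s <= v)%MM.
  apply/mnm_lepP => i; rewrite -[v in leqRHS](emb_high (le_m_n t U)) mnmDE mnmE.
  apply: leq_trans (leq_addr _ _); rewrite mnmE -[in leqRHS](cat_take_drop d.+1 (word _)).
  by rewrite count_cat leq_addr.
have s_f : mono_of n s \in msupp f by rewrite mcoeff_msupp f1 oner_neq0.
exists ('X_[v - mono_of n s] * f); first exact: ideal_changeM.
split.
  by rewrite mcoeff_msupp -[v in _@_v](submK s_v) mulrC mcoeffMX f1 oner_neq0.
move=> y; rewrite mulrC => /msuppM_le/allpairsP[[x z] /= [x_f /mem_msuppXP <- ->]] neq_v.
rewrite -[v in degrevlex_lt _ v](submK s_v) addmC degrevlex_add degrevlexE.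
rewrite (dhomog_mf f_homog x_f) (dhomog_mf f_homog s_f) eqxx ltnn /=.
by case: (f_lt x x_f) => // eq_x; move: neq_v; rewrite eq_x addmC submK // eqxx.
Qed.

Lemma initial_ideal_squeezed p :
  initial_ideal I p <-> ideal_ext (@poly_incl K m t d) (order_ideal_compl K U) p.
Proof.
have I_lin : linear_pred I by apply: ideal_change_linear.
have nonstd v : ~~ (low v \in U) -> exists2 f, I f & initial_monomial f v.
  exact: initial_nonstandard.
have free r : I r -> (forall y, y \in msupp r -> low y \in U) -> r = 0.
  apply: (@standard_free K m n (le_m_n t U) g (squeezed t U) U (facet t d)) => //.
  - exact: fset_uniq.
  - by move=> u /mdeg_dmax u_d; have := cardsC (facet t d u); rewrite card_facet // card_ord; lia.
  - move=> u v /mdeg_dmax u_d /mdeg_dmax v_d sub_uv; apply: (facet_inj u_d v_d).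
    by apply/eqP; rewrite eqEcard !card_facet // leqnn andbT; exact: sub_uv.
  - move=> A u A_D u_U; apply: contra A_D => sub_A; rewrite inE; apply/hasP.
    by exists u.
  - exact: (@normal_form _ _ _ [pred v | low v \in U]).
split.
  apply: ideal_gen_min; try exact: ideal_gen0; try exact: ideal_genD; try exact: ideal_genM.
  move=> _ [q [v [Iq v_q ->]]]; apply/(extended_complP U_order) => y /mem_msuppXP <-.
  exact: (@initial_standard _ _ I [pred v | low v \in U] I_lin nonstd free q v Iq v_q).
move=> /(extended_complP U_order).
rewrite [X in initial_ideal _ X]mpolyE; elim: (msupp p) => [|v s IH] s_low.
  by rewrite big_nil; apply: ideal_gen0.
rewrite big_cons; apply: ideal_genD; last by apply: IH => y y_s; rewrite s_low // in_cons y_s orbT.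
rewrite -mul_mpolyC; apply: ideal_genM; apply: ideal_gen_mem.
by have [f If f_v] := nonstd v (s_low v (mem_head _ _)); exists f, v.
Qed.

End Squeezed.

Lemma generic_initial_squeezed (K : fieldType) (m t : nat) (U : {fset 'X_{1..m}}) :
    order_ideal U -> shifted U -> infinite_type K ->
  generic_initial (stanley_reisner K (squeezed t U))
    (ideal_ext (@poly_incl K m t (dmax U)) (order_ideal_compl K U)).
Proof.
move=> hU hS K_inf; exists (fun g => g \in unitmx /\ general_position g); split.
- exact: general_position_open.
- exact: general_position_exists.
by move=> g [g_unit g_good] p; apply: initial_ideal_squeezed.
Qed.

Theorem proposition4p1 (K : fieldType) (m t : nat) (U : {fset 'X_{1..m}})
    (hm : (1 <= m)%N) (hU : order_ideal U) (hS : shifted U) :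
  is_gin (stanley_reisner K (squeezed t U))
         (ideal_ext (@poly_incl K m t (dmax U)) (order_ideal_compl K U)).
Proof.
split=> [K_inf | _ L iota L_inf]; first exact: generic_initial_squeezed.
apply: generic_initial_ext (generic_initial_squeezed t hU hS L_inf) => p.
  exact: scalar_ext_stanley_reisner.
exact: scalar_ext_extended_compl.
Qed.
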